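(* For a linear map $P:\mathcal{M}_2\to\mathcal{M}_2$ the following are equivalent: (1) $P\otimes P:\mathcal{M}_2\otimes\mathcal{M}_2\to\mathcal{M}_2\otimes\mathcal{M}_2$ is positive; (2) $P\otimes P$ is decomposable.
   Context: $\mathcal{M}_d$ denotes the complex $d\times d$ matrices. A linear map $L:\mathcal{M}_{d_1}\to\mathcal{M}_{d_2}$ is positive if it maps positive semidefinite matrices to positive semidefinite matrices, completely positive if $\mathrm{id}_k\otimes L$ is positive for all $k\in\mathbb{N}$, and decomposable if $L=T+\vartheta_{d_2}\circ S$ for completely positive maps $T,S:\mathcal{M}_{d_1}\to\mathcal{M}_{d_2}$, where $\vartheta_{d}(X)=X^T$ is the transpose in the computational basis. *)

(* Defs.v *)
From HB Require Import structures.
From mathcomp Require Import all_boot all_order all_algebra.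
From mathcomp Require Import complex mxtens.
From mathcomp Require Import reals.
Set Implicit Arguments. Unset Strict Implicit. Unset Printing Implicit Defensive.
Import Order.TTheory GRing.Theory Num.Theory.
Local Open Scope ring_scope.

Section Defs.
Variable C : numClosedFieldType.

Definition adjmx {m n} (A : 'M[C]_(m, n)) : 'M[C]_(n, m) := (map_mx Num.conj A)^T.

Definition psd {n} (A : 'M[C]_n) : Prop :=
  adjmx A = A /\ forall x : 'cV[C]_n, 0 <= (adjmx x *m A *m x) 0 0.

Definition positive_map {d1 d2} (L : 'M[C]_d1 -> 'M[C]_d2) : Prop :=
  forall X, psd X -> psd (L X).

(* tensor product L1 (x) L2 of linear maps, acting on M_a1 (x) M_a2 = M_(a1*a2)
   (Kronecker identification, index (i,k) |-> mxtens_index (i,k)), defined by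
   (L1 (x) L2)(E_ij (x) E_kl) = L1(E_ij) (x) L2(E_kl) and linear extension. *)
Definition tensmap {a1 b1 a2 b2}
  (L1 : 'M[C]_a1 -> 'M[C]_b1) (L2 : 'M[C]_a2 -> 'M[C]_b2)
  (X : 'M[C]_(a1 * a2)) : 'M[C]_(b1 * b2) :=
  \sum_(i < a1) \sum_(j < a1) \sum_(k < a2) \sum_(l < a2)
     X (mxtens_index (i, k)) (mxtens_index (j, l))
       *: (L1 (delta_mx i j) *t L2 (delta_mx k l)).

Definition completely_positive {d1 d2} (L : 'M[C]_d1 -> 'M[C]_d2) : Prop :=
  forall k : nat, positive_map (tensmap (fun X : 'M[C]_k => X) L).

Definition decomposable {d1 d2} (L : 'M[C]_d1 -> 'M[C]_d2) : Prop :=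
  exists (T S : {linear 'M[C]_d1 -> 'M[C]_d2}),
    completely_positive T /\ completely_positive S /\
    forall X, L X = T X + (S X)^T.
End Defs.

(* Main.v *)
(* Decomposability is a closed condition, and P + e tr(.) 1 inherits the
   positivity of its tensor square from P, so P may be assumed to map nonzero
   positive semidefinite matrices to positive definite ones. Maximizing
   det X / det P(X) over the density matrices X then gives a point where P,
   composed on both sides with invertible conjugations, becomes unital and trace
   preserving, and a pair of singular vectors of its Bloch matrix yields unitaries
   that bring it to the form P = sum_i p_i e_i, where e_i is the conjugation by
   the i-th Pauli matrix. Evaluating P (x) P at the maximally entangled state
   gives p_i p_j + p_k p_l >= 0 whenever {i, j, k, l} = {0, 1, 2, 3}. The maps
   u_k = 1/2 sum_i e_i - e_k are completely copositive, and these inequalities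
   are exactly what is needed to find nonnegative t, s such that
   sum p_i p_j e_i (x) e_j = sum t_ij e_i (x) e_j + sum s_kl u_k (x) u_l. *)

Require Import Defs.
From HB Require Import structures.
From mathcomp Require Import all_boot all_order all_algebra.
From mathcomp Require Import complex mxtens.
From mathcomp Require Import reals.
From mathcomp Require Import perm polyrcf ring lra.
From mathcomp Require Import boolp classical_sets functions topology.
From mathcomp Require Import normedtype derive.
Set Implicit Arguments. Unset Strict Implicit. Unset Printing Implicit Defensive.
Import Order.TTheory GRing.Theory Num.Theory.
Import numFieldNormedType.Exports.
Local Open Scope ring_scope.

(** Positivity of P (x) P determines P only up to sign, so P or - P is shown positive beforehand;
    both have the same tensor square. This matters because the cross terms P (x) tr(.) 1 of the
    perturbed square are positive only when P is. The perturbation keeps det P(X) away from 0 on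
    density matrices, so the ratio of determinants attains its maximum, and it does so at an
    invertible X0, since the ratio vanishes on singular matrices. Once X0 and P(X0) are moved to 1,
    stationarity of the ratio at 1 says that P sends traceless matrices to traceless ones. One pair
    of singular vectors is enough: it splits off the z axis, and phases of diagonal unitaries
    diagonalize what remains in the xy plane. The inequalities have this origin: e_i (x) e_j maps
    the maximally entangled state to the Bell state labelled by the product of i and j in the Klein
    four-group, so its image under P (x) P has Bell weights sum p_i^2 and 2 (p_i p_j + p_k p_l). *)

Section Adjoint.
Variable C : numClosedFieldType.

Lemma adjmxE m n (A : 'M[C]_(m, n)) i j : adjmx A i j = (A j i)^*.
Proof. by rewrite !mxE. Qed.

Lemma adjmxK m n (A : 'M[C]_(m, n)) : adjmx (adjmx A) = A.
Proof. by apply/matrixP => i j; rewrite !adjmxE conjCK. Qed.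

Lemma adjmxM m n p (A : 'M[C]_(m, n)) (B : 'M_(n, p)) :
  adjmx (A *m B) = adjmx B *m adjmx A.
Proof. by rewrite /adjmx map_mxM trmx_mul. Qed.

Lemma adjmxD m n (A B : 'M[C]_(m, n)) : adjmx (A + B) = adjmx A + adjmx B.
Proof. by rewrite /adjmx map_mxD linearD. Qed.

Lemma adjmxZ m n a (A : 'M[C]_(m, n)) : adjmx (a *: A) = a^* *: adjmx A.
Proof. by rewrite /adjmx map_mxZ linearZ. Qed.

Lemma adjmx0 m n : adjmx (0 : 'M[C]_(m, n)) = 0.
Proof. by apply/matrixP => i j; rewrite !mxE conjC0. Qed.

Lemma adjmx1 n : adjmx (1%:M : 'M[C]_n) = 1%:M.
Proof. by rewrite /adjmx map_mx1 trmx1. Qed.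

Lemma adjmx_tens m n p q (A : 'M[C]_(m, n)) (B : 'M[C]_(p, q)) :
  adjmx (A *t B) = adjmx A *t adjmx B.
Proof. by rewrite /adjmx map_mxT trmx_tens. Qed.

Lemma adjmx_delta m n i j :
  adjmx (delta_mx i j : 'M[C]_(m, n)) = delta_mx j i.
Proof. by rewrite /adjmx map_delta_mx trmx_delta. Qed.

Lemma adjmx_inv n (A : 'M[C]_n) : adjmx (invmx A) = invmx (adjmx A).
Proof. by rewrite /adjmx map_invmx trmx_inv. Qed.

Lemma adjmx_unit n (A : 'M[C]_n) : (adjmx A \in unitmx) = (A \in unitmx).
Proof. by rewrite /adjmx unitmx_tr map_unitmx. Qed.

End Adjoint.

(** * Positive semidefinite matrices and their quadratic forms *)

Section Psd.
Variable C : numClosedFieldType.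

Definition qform n (A : 'M[C]_n) (x : 'cV[C]_n) : C := (adjmx x *m A *m x) 0 0.

Lemma qformE n (A : 'M[C]_n) x :
  qform A x = \sum_i \sum_j (x i 0)^* * A i j * x j 0.
Proof.
rewrite /qform mxE exchange_big /=; apply: eq_bigr => j _.
by rewrite mxE mulr_suml; apply: eq_bigr => i _; rewrite adjmxE.
Qed.

Lemma qformD n (A B : 'M[C]_n) x : qform (A + B) x = qform A x + qform B x.
Proof. by rewrite /qform mulmxDr mulmxDl mxE. Qed.

Lemma qformZ n a (A : 'M[C]_n) x : qform (a *: A) x = a * qform A x.
Proof. by rewrite /qform -scalemxAr -scalemxAl mxE. Qed.

Lemma qform_congr m n (K : 'M[C]_(m, n)) A x :
  qform (K *m A *m adjmx K) x = qform A (adjmx K *m x).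
Proof. by rewrite /qform adjmxM adjmxK !mulmxA. Qed.

Lemma qform_adj n (A : 'M[C]_n) x : qform (adjmx A) x = (qform A x)^*.
Proof. by rewrite /qform -adjmxE !adjmxM adjmxK mulmxA. Qed.

Lemma mulmx_delta_mid n (A : 'M[C]_n) i j :
  (adjmx (delta_mx i 0 : 'cV[C]_n) *m A *m (delta_mx j 0 : 'cV_n)) 0 0 = A i j.
Proof. by rewrite adjmx_delta -rowE -colE !mxE. Qed.

Lemma qform_deltaD n (A : 'M[C]_n) i j c :
  qform A (delta_mx i 0 + c *: delta_mx j 0) =
  A i i + c * A i j + c^* * A j i + c * c^* * A j j.
Proof.
rewrite /qform adjmxD adjmxZ mulmxDl mulmxDl !mulmxDr.
rewrite -!scalemxAl -!scalemxAr.
have addE (X Y : 'M[C]_1) : (X + Y) 0 0 = X 0 0 + Y 0 0 by rewrite mxE.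
have sclE a (X : 'M[C]_1) : (a *: X) 0 0 = a * X 0 0 by rewrite mxE.
by rewrite !(addE, sclE) !mulmx_delta_mid; ring.
Qed.

(** Polarization: the vectors e_i + c e_j with c = 1 and c = i isolate the sum and the difference of
    the two off-diagonal entries. *)
Lemma qform_eq0 n (A : 'M[C]_n) : (forall x, qform A x = 0) -> A = 0.
Proof.
move=> A0; apply/matrixP => i j; rewrite mxE.
have diag k : A k k = 0 by rewrite -mulmx_delta_mid; apply: A0.
have cross c : c * A i j + c^* * A j i = 0.
  rewrite -(A0 (delta_mx i 0 + c *: delta_mx j 0)) qform_deltaD !diag.
  by rewrite mulr0 addr0 add0r.
have H1 := cross 1; have Hi := cross 'i.
rewrite conjC1 !mul1r in H1; rewrite conjCi in Hi.
have H2 : A i j - A j i = 0.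
  have : 'i * (A i j - A j i) = 0 by rewrite -[RHS]Hi; ring.
  by move/eqP; rewrite mulf_eq0 (negPf (neq0Ci C)) /= => /eqP.
have : 2%:R * A i j = 0 by rewrite -[RHS](addr0 0) -{1}H1 -H2; ring.
by move/eqP; rewrite mulf_eq0 pnatr_eq0 /= => /eqP.
Qed.

Lemma psd_ge0 n (A : 'M[C]_n) x : psd A -> 0 <= qform A x.
Proof. by case=> _; apply. Qed.

Lemma psd_adj n (A : 'M[C]_n) : psd A -> adjmx A = A.
Proof. by case. Qed.

(** A form with real values agrees with the form of the adjoint, so polarization yields the
    Hermitian half of [psd]. *)
Lemma psdP n (A : 'M[C]_n) : psd A <-> forall x, 0 <= qform A x.
Proof.
split=> [[]//|A0]; split=> //.
apply/eqP; rewrite -subr_eq0; apply/eqP/qform_eq0 => x.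
rewrite qformD -scaleN1r qformZ qform_adj mulN1r.
by rewrite geC0_conj ?subrr.
Qed.

Lemma psdD n (A B : 'M[C]_n) : psd A -> psd B -> psd (A + B).
Proof.
by move=> /psdP pA /psdP pB; apply/psdP => x; rewrite qformD addr_ge0.
Qed.

Lemma psdZ n a (A : 'M[C]_n) : 0 <= a -> psd A -> psd (a *: A).
Proof.
by move=> a0 /psdP pA; apply/psdP => x; rewrite qformZ mulr_ge0.
Qed.

Lemma psd0 n : psd (0 : 'M[C]_n).
Proof. by apply/psdP => x; rewrite /qform mulmx0 mul0mx mxE. Qed.

Lemma psd_sum (I : Type) (r : seq I) (P : pred I) n (F : I -> 'M[C]_n) :
  (forall i, P i -> psd (F i)) -> psd (\sum_(i <- r | P i) F i).
Proof. by move=> H; apply: big_ind => //; [apply: psd0 | apply: psdD]. Qed.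

Lemma psd_congr m n (K : 'M[C]_(m, n)) A :
  psd A -> psd (K *m A *m adjmx K).
Proof. by move=> /psdP pA; apply/psdP => x; rewrite qform_congr. Qed.

Lemma psd1 n : psd (1%:M : 'M[C]_n).
Proof.
apply/psdP => x; rewrite /qform mulmx1 mxE sumr_ge0 // => i _.
by rewrite adjmxE mulrC mul_conjC_ge0.
Qed.

Lemma psd_rank1 n (v : 'cV[C]_n) : psd (v *m adjmx v).
Proof. by rewrite -[v in v *m _]mulmx1; apply/psd_congr/psd1. Qed.

Lemma psd_delta n (i : 'I_n) : psd (delta_mx i i : 'M[C]_n).
Proof.
have -> : delta_mx i i = delta_mx i 0 *m adjmx (delta_mx i 0 : 'cV[C]_n).
  by rewrite adjmx_delta mul_delta_mx.
exact: psd_rank1.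
Qed.

Lemma psd_tr n (A : 'M[C]_n) : psd A -> psd A^T.
Proof.
move=> /psdP pA; apply/psdP => x.
suff -> : qform A^T x = qform A (map_mx Num.conj x) by [].
rewrite !qformE exchange_big; apply: eq_bigr => i _; apply: eq_bigr => j _.
by rewrite !mxE conjCK; ring.
Qed.

Lemma qform_delta n (A : 'M[C]_n) i : qform A (delta_mx i 0) = A i i.
Proof. by rewrite /qform adjmx_delta -rowE -colE !mxE. Qed.

Lemma psd_diag_ge0 n (A : 'M[C]_n) i : psd A -> 0 <= A i i.
Proof. by move=> /psdP /(_ (delta_mx i 0)); rewrite qform_delta. Qed.

Lemma psd_pair n (A : 'M[C]_n) i j c : psd A ->
  0 <= A i i + c * A i j + c^* * A j i + c * c^* * A j j.
Proof.
by move=> /psdP /(_ (delta_mx i 0 + c *: delta_mx j 0)); rewrite qform_deltaD.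
Qed.

Lemma psd_trace_ge0 n (A : 'M[C]_n) : psd A -> 0 <= \tr A.
Proof. by move=> pA; apply: sumr_ge0 => i _; apply: psd_diag_ge0. Qed.

Lemma psd_cast n n' (e : n = n') (A : 'M[C]_n) :
  psd A -> psd (castmx (e, e) A).
Proof. by case: n' / e; rewrite castmx_id. Qed.

End Psd.

(** * Algebra of tensor products of maps *)

Section TensorMaps.
Variable C : numClosedFieldType.

Definition conjg_mx m n (K : 'M[C]_(m, n)) (X : 'M[C]_n) : 'M[C]_m :=
  K *m X *m adjmx K.

Lemma conjg_mx_is_linear m n (K : 'M[C]_(m, n)) : linear (conjg_mx K).
Proof.
move=> a X Y; rewrite /conjg_mx mulmxDr mulmxDl -scalemxAr -scalemxAl //.
Qed.
HB.instance Definition _ m n (K : 'M[C]_(m, n)) :=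
  GRing.isLinear.Build C 'M[C]_n 'M[C]_m _ (conjg_mx K) (conjg_mx_is_linear K).

Lemma tensmap_is_linear a1 b1 a2 b2 (L1 : 'M[C]_a1 -> 'M[C]_b1)
  (L2 : 'M[C]_a2 -> 'M[C]_b2) : linear (tensmap L1 L2).
Proof.
move=> c X Y; rewrite /tensmap !(scaler_sumr, =^~ big_split) /=.
do 4 (rewrite ?scaler_sumr -?big_split /=; apply: eq_bigr => ? _).
by rewrite !mxE scalerDl scalerA.
Qed.
HB.instance Definition _ a1 b1 a2 b2 (L1 : 'M[C]_a1 -> 'M[C]_b1)
  (L2 : 'M[C]_a2 -> 'M[C]_b2) :=
  GRing.isLinear.Build C 'M[C]_(a1 * a2) 'M[C]_(b1 * b2) _
    (tensmap L1 L2) (tensmap_is_linear L1 L2).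

Lemma tensmx_sumE m n p q (X : 'M[C]_(m * n, p * q)) :
  X = \sum_i \sum_j \sum_k \sum_l
     X (mxtens_index (i, k)) (mxtens_index (j, l))
       *: (delta_mx i j *t delta_mx k l).
Proof.
apply/matrixP => r s; case: (mxtens_indexP r) => i k {r}.
case: (mxtens_indexP s) => j l {s}.
rewrite summxE.
rewrite (bigD1 i) //= [X in _ + X]big1 ?addr0; last first.
  move=> i' /negPf ni; rewrite summxE big1 // => j' _.
  rewrite summxE big1 // => k' _; rewrite summxE big1 // => l' _.
  by rewrite mxE tensmxE !mxE eq_sym ni /= mul0r mulr0.
rewrite summxE (bigD1 j) //= [X in _ + X]big1 ?addr0; last first.
  move=> j' /negPf nj; rewrite summxE big1 // => k' _.
  rewrite summxE big1 // => l' _.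
  by rewrite mxE tensmxE !mxE [j == _]eq_sym nj andbF /= mul0r mulr0.
rewrite summxE (bigD1 k) //= [X in _ + X]big1 ?addr0; last first.
  move=> k' /negPf nk; rewrite summxE big1 // => l' _.
  by rewrite mxE tensmxE !mxE [k == _]eq_sym nk /= mulr0 mulr0.
rewrite summxE (bigD1 l) //= [X in _ + X]big1 ?addr0; last first.
  move=> l' /negPf nl.
  by rewrite mxE tensmxE !mxE [l == _]eq_sym nl andbF /= mulr0 mulr0.
by rewrite mxE tensmxE !mxE !eqxx !mulr1.
Qed.

Lemma tensmxDl m n p q (A A' : 'M[C]_(m, n)) (B : 'M[C]_(p, q)) :
  (A + A') *t B = A *t B + A' *t B.
Proof. by apply/matrixP => i j; rewrite !mxE mulrDl. Qed.

Lemma tensmxZl m n p q c (A : 'M[C]_(m, n)) (B : 'M[C]_(p, q)) :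
  (c *: A) *t B = c *: (A *t B).
Proof. by apply/matrixP => i j; rewrite !mxE mulrA. Qed.

Lemma tensmx_suml (I : finType) m n p q (F : I -> 'M[C]_(m, n))
    (B : 'M[C]_(p, q)) : (\sum_i F i) *t B = \sum_i F i *t B.
Proof.
apply: (big_morph (fun A => A *t B)); last exact: tens0mx.
by move=> X Y; rewrite tensmxDl.
Qed.

Lemma tensmxDr m n p q (A : 'M[C]_(m, n)) (B B' : 'M[C]_(p, q)) :
  A *t (B + B') = A *t B + A *t B'.
Proof. by apply/matrixP => i j; rewrite !mxE mulrDr. Qed.

Lemma tensmxZr m n p q c (A : 'M[C]_(m, n)) (B : 'M[C]_(p, q)) :
  A *t (c *: B) = c *: (A *t B).
Proof. by apply/matrixP => i j; rewrite !mxE mulrCA. Qed.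

Lemma tensmx_sumr (I : finType) m n p q (A : 'M[C]_(m, n))
    (F : I -> 'M[C]_(p, q)) : A *t (\sum_i F i) = \sum_i A *t F i.
Proof.
apply: (big_morph (tensmx A)); last exact: tensmx0.
by move=> X Y; rewrite tensmxDr.
Qed.

Lemma linear_delta d n (L : {linear 'M[C]_d -> 'M[C]_n}) A :
  L A = \sum_i \sum_j A i j *: L (delta_mx i j).
Proof.
rewrite {1}[A]matrix_sum_delta linear_sum; apply: eq_bigr => i _.
by rewrite linear_sum; apply: eq_bigr => j _; rewrite linearZ.
Qed.

Lemma linear_delta_ext d n (F G : {linear 'M[C]_d -> 'M[C]_n}) :
  (forall i j, F (delta_mx i j) = G (delta_mx i j)) -> F =1 G.
Proof.
move=> FG X; rewrite (linear_delta F) (linear_delta G).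
by apply: eq_bigr => i _; apply: eq_bigr => j _; rewrite FG.
Qed.

(** Kronecker products span, which reduces identities between tensor maps to product matrices. *)
Lemma linear_tens_ext a1 a2 n (F G : {linear 'M[C]_(a1 * a2) -> 'M[C]_n}) :
  (forall A B, F (A *t B) = G (A *t B)) -> F =1 G.
Proof.
move=> FG X; rewrite [X]tensmx_sumE.
do 4 (rewrite !linear_sum; apply: eq_bigr => ? _).
by rewrite !linearZ /= FG.
Qed.

Lemma tensmap_tens a1 b1 a2 b2 (L1 : {linear 'M[C]_a1 -> 'M[C]_b1})
    (L2 : {linear 'M[C]_a2 -> 'M[C]_b2}) A B :
  tensmap L1 L2 (A *t B) = L1 A *t L2 B.
Proof.
rewrite [in RHS](linear_delta L1) tensmx_suml.
apply: eq_bigr => i _.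
rewrite tensmx_suml; apply: eq_bigr => j _.
rewrite (linear_delta L2) tensmx_sumr; apply: eq_bigr => k _.
rewrite tensmx_sumr; apply: eq_bigr => l _.
rewrite tensmxE tensmxZr tensmxZl.
by rewrite scalerA mulrC.
Qed.

Lemma tensmap_comp a1 b1 c1 a2 b2 c2
    (L1 : {linear 'M[C]_b1 -> 'M[C]_c1}) (L2 : {linear 'M[C]_b2 -> 'M[C]_c2})
    (M1 : 'M[C]_a1 -> 'M[C]_b1) (M2 : 'M[C]_a2 -> 'M[C]_b2) X :
  tensmap L1 L2 (tensmap M1 M2 X) = tensmap (L1 \o M1) (L2 \o M2) X.
Proof.
rewrite {2}/tensmap.
do 4 (rewrite linear_sum; apply: eq_bigr => ? _).
by rewrite linearZ /= tensmap_tens.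
Qed.

Lemma eq_tensmap a1 b1 a2 b2 (L1 M1 : 'M[C]_a1 -> 'M[C]_b1)
    (L2 M2 : 'M[C]_a2 -> 'M[C]_b2) :
  L1 =1 M1 -> L2 =1 M2 -> tensmap L1 L2 =1 tensmap M1 M2.
Proof.
move=> e1 e2 X; rewrite /tensmap.
by do 4 (apply: eq_bigr => ? _); rewrite e1 e2.
Qed.

Lemma tensmapDl a1 b1 a2 b2 (L1 M1 : 'M[C]_a1 -> 'M[C]_b1)
    (L2 : 'M[C]_a2 -> 'M[C]_b2) X :
  tensmap (fun Y => L1 Y + M1 Y) L2 X = tensmap L1 L2 X + tensmap M1 L2 X.
Proof.
rewrite /tensmap; do 4 (rewrite -big_split /=; apply: eq_bigr => ? _).
by rewrite tensmxDl scalerDr.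
Qed.

Lemma tensmapDr a1 b1 a2 b2 (L1 : 'M[C]_a1 -> 'M[C]_b1)
    (L2 M2 : 'M[C]_a2 -> 'M[C]_b2) X :
  tensmap L1 (fun Y => L2 Y + M2 Y) X = tensmap L1 L2 X + tensmap L1 M2 X.
Proof.
rewrite /tensmap; do 4 (rewrite -big_split /=; apply: eq_bigr => ? _).
by rewrite tensmxDr scalerDr.
Qed.

Lemma tensmapZl a1 b1 a2 b2 c (L1 : 'M[C]_a1 -> 'M[C]_b1)
    (L2 : 'M[C]_a2 -> 'M[C]_b2) X :
  tensmap (fun Y => c *: L1 Y) L2 X = c *: tensmap L1 L2 X.
Proof.
rewrite /tensmap; do 4 (rewrite scaler_sumr; apply: eq_bigr => ? _).
by rewrite tensmxZl !scalerA mulrC.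
Qed.

Lemma tensmapZr a1 b1 a2 b2 c (L1 : 'M[C]_a1 -> 'M[C]_b1)
    (L2 : 'M[C]_a2 -> 'M[C]_b2) X :
  tensmap L1 (fun Y => c *: L2 Y) X = c *: tensmap L1 L2 X.
Proof.
rewrite /tensmap; do 4 (rewrite scaler_sumr; apply: eq_bigr => ? _).
by rewrite tensmxZr !scalerA mulrC.
Qed.

Lemma tensmap_suml a1 b1 a2 b2 (I : finType) (L1 : I -> 'M[C]_a1 -> 'M[C]_b1)
    (L2 : 'M[C]_a2 -> 'M[C]_b2) X :
  tensmap (fun Y => \sum_i L1 i Y) L2 X = \sum_i tensmap (L1 i) L2 X.
Proof.
rewrite /tensmap; do 4 (rewrite [RHS]exchange_big; apply: eq_bigr => ? _).
by rewrite tensmx_suml scaler_sumr.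
Qed.

Lemma tensmap_sumr a1 b1 a2 b2 (I : finType) (L1 : 'M[C]_a1 -> 'M[C]_b1)
    (L2 : I -> 'M[C]_a2 -> 'M[C]_b2) X :
  tensmap L1 (fun Y => \sum_i L2 i Y) X = \sum_i tensmap L1 (L2 i) X.
Proof.
rewrite /tensmap; do 4 (rewrite [RHS]exchange_big; apply: eq_bigr => ? _).
by rewrite tensmx_sumr scaler_sumr.
Qed.

Lemma tensmap_conjg m n p q (K : 'M[C]_(m, n)) (J : 'M[C]_(p, q)) :
  tensmap (conjg_mx K) (conjg_mx J) =1 conjg_mx (K *t J).
Proof.
apply: linear_tens_ext => A B /=; rewrite tensmap_tens /conjg_mx.
by rewrite adjmx_tens !tensmx_mul.
Qed.

Lemma tensmap_id_conjg k m n (K : 'M[C]_(m, n)) :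
  tensmap (fun X : 'M[C]_k => X) (conjg_mx K) =1 conjg_mx (1%:M *t K).
Proof.
move=> X; rewrite -tensmap_conjg; apply: eq_tensmap => // Y.
by rewrite /conjg_mx adjmx1 mul1mx mulmx1.
Qed.

Lemma tensmap_trmx a1 b1 a2 b2 (L1 : 'M[C]_a1 -> 'M[C]_b1)
    (L2 : 'M[C]_a2 -> 'M[C]_b2) X :
  tensmap (fun Y => (L1 Y)^T) (fun Y => (L2 Y)^T) X = (tensmap L1 L2 X)^T.
Proof.
rewrite /tensmap; do 4 (rewrite linear_sum; apply: eq_bigr => ? _).
by rewrite linearZ /= trmx_tens.
Qed.

End TensorMaps.

(** * Positive, completely positive and decomposable maps *)

Section Cones.
Variable C : numClosedFieldType.

Lemma eq_positive d1 d2 (L M : 'M[C]_d1 -> 'M[C]_d2) :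
  L =1 M -> positive_map L -> positive_map M.
Proof. by move=> e pL X /pL; rewrite e. Qed.

Lemma positive_conjg m n (K : 'M[C]_(m, n)) : positive_map (conjg_mx K).
Proof. by move=> X; apply: psd_congr. Qed.

Lemma positive_comp d1 d2 d3 (L : 'M[C]_d2 -> 'M[C]_d3)
    (M : 'M[C]_d1 -> 'M[C]_d2) :
  positive_map L -> positive_map M -> positive_map (fun X => L (M X)).
Proof. by move=> pL pM X /pM /pL. Qed.

Lemma eq_cp d1 d2 (L M : 'M[C]_d1 -> 'M[C]_d2) :
  L =1 M -> completely_positive L -> completely_positive M.
Proof. by move=> e cL k; apply: eq_positive (cL k); apply: eq_tensmap. Qed.

Lemma cp_conjg m n (K : 'M[C]_(m, n)) : completely_positive (conjg_mx K).
Proof. by move=> k X pX; rewrite tensmap_id_conjg; apply: psd_congr. Qed.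

Lemma cp_comp d1 d2 d3 (L : {linear 'M[C]_d2 -> 'M[C]_d3})
    (M : 'M[C]_d1 -> 'M[C]_d2) :
  completely_positive L -> completely_positive M ->
  completely_positive (fun X => L (M X)).
Proof.
move=> cL cM k X pX.
rewrite -(tensmap_comp [the {linear 'M[C]_k -> 'M[C]_k} of idfun] L idfun M).
exact/cL/cM.
Qed.

Lemma cpZ d1 d2 a (L : 'M[C]_d1 -> 'M[C]_d2) :
  0 <= a -> completely_positive L -> completely_positive (fun X => a *: L X).
Proof. by move=> a0 cL k X pX; rewrite tensmapZr; apply: psdZ => //; apply: cL. Qed.

Lemma cp_sum d1 d2 (I : finType) (L : I -> 'M[C]_d1 -> 'M[C]_d2) :
  (forall i, completely_positive (L i)) ->
  completely_positive (fun X => \sum_i L i X).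
Proof.
move=> cL k X pX; rewrite tensmap_sumr.
by apply: psd_sum => i _; apply: cL.
Qed.

Lemma cp_positive d1 d2 (L : {linear 'M[C]_d1 -> 'M[C]_d2}) :
  completely_positive L -> positive_map L.
Proof.
move=> /(_ 1%N) cL X pX.
(* Tensoring with M_1 changes nothing except the type, from n to 1 * n; [castmx] carries this
   equality. *)
have e n (Y : 'M[C]_n) : Y = castmx (mul1n n, mul1n n) ((1 : 'M_1) *t Y).
  by rewrite tens_scalar1mx castmx_comp castmx_id.
rewrite [L X]e; apply: psd_cast.
rewrite -(tensmap_tens [the {linear 'M[C]_1 -> 'M[C]_1} of idfun] L).
apply: cL; rewrite tens_scalar1mx; exact: psd_cast.
Qed.

Lemma decomposable_positive d1 d2 (L : 'M[C]_d1 -> 'M[C]_d2) :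
  decomposable L -> positive_map L.
Proof.
case=> T [S [cT [cS LTS]]] X pX; rewrite LTS; apply: psdD.
  exact: cp_positive.
exact/psd_tr/cp_positive.
Qed.

(** Transposition turns conjugation by K into conjugation by its entrywise conjugate, which is why
    the latter is applied to the copositive part. *)
Lemma decomposable_conjg d1 d2 d3 d4 (L : 'M[C]_d2 -> 'M[C]_d3)
    (K : 'M[C]_(d4, d3)) (J : 'M[C]_(d2, d1)) :
  decomposable L -> decomposable (fun X => conjg_mx K (L (conjg_mx J X))).
Proof.
case=> T [S [cT [cS LTS]]].
exists [the {linear 'M[C]_d1 -> 'M[C]_d4} of conjg_mx K \o T \o conjg_mx J].
exists [the {linear 'M[C]_d1 -> 'M[C]_d4} of
  conjg_mx (map_mx Num.conj K) \o S \o conjg_mx J].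
split; [|split].
- apply: (@cp_comp _ _ _ [the {linear _ -> _} of conjg_mx K]
    (fun X => T (conjg_mx J X))); first exact: cp_conjg.
  by apply: (@cp_comp _ _ _ T (conjg_mx J)) => //; apply: cp_conjg.
- apply: (@cp_comp _ _ _ 
    [the {linear _ -> _} of conjg_mx (map_mx Num.conj K)]
    (fun X => S (conjg_mx J X))); first exact: (cp_conjg (map_mx Num.conj K)).
  by apply: (@cp_comp _ _ _ S (conjg_mx J)) => //; apply: cp_conjg.
move=> X /=; rewrite LTS linearD /=; congr (_ + _).
rewrite /conjg_mx !trmx_mul mulmxA; congr (_ *m _ *m _).
by apply/matrixP => i j; rewrite !mxE conjCK.
Qed.

Lemma eq_decomposable d1 d2 (L M : 'M[C]_d1 -> 'M[C]_d2) :
  L =1 M -> decomposable L -> decomposable M.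
Proof.
move=> e [T [S [cT [cS LTS]]]]; exists T, S; split=> //; split=> // X.
by rewrite -e.
Qed.

(** Unnormalized projector onto the maximally entangled state; id (x) L sends it to the Choi matrix
    of L. *)
Definition choi_id n : 'M[C]_(n * n) :=
  \sum_i \sum_j delta_mx i j *t delta_mx i j.

Lemma psd_choi_id n : psd (choi_id n).
Proof.
pose B : 'M[C]_(n * n, 1 * 1) := \sum_i delta_mx i 0 *t delta_mx i 0.
have aB : adjmx B = \sum_i delta_mx 0 i *t delta_mx 0 i.
  rewrite /B (big_morph (@adjmx C _ _) (@adjmxD _ _ _) (@adjmx0 _ _ _)).
  by apply: eq_bigr => i _; rewrite adjmx_tens !adjmx_delta.
suff -> : choi_id n = B *m 1%:M *m adjmx B by apply/psd_congr/psd1.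
rewrite mulmx1 aB mulmx_suml; apply: eq_bigr => i _.
rewrite mulmx_sumr; apply: eq_bigr => j _.
by rewrite tensmx_mul !mul_delta_mx.
Qed.

End Cones.

(** * Explicit calculus of 2 by 2 matrices *)

Lemma ord2P (i : 'I_2) : i = 0 \/ i = 1.
Proof. by case: i => [[|[|//]] Hi]; [left|right]; apply: val_inj. Qed.

Lemma big_ord2 (V : nmodType) (F : 'I_2 -> V) : \sum_i F i = F 0 + F 1.
Proof.
by rewrite !big_ord_recl big_ord0 addr0; congr (_ + F _); apply: val_inj.
Qed.

Section Mx2.
Variable K : comNzRingType.

Definition mx2 (a b c d : K) : 'M[K]_2 :=
  \matrix_(i, j) (if i == 0 then if j == 0 then a else b
                  else if j == 0 then c else d).

Lemma mx2E a b c d : ((mx2 a b c d 0 0 = a) * (mx2 a b c d 0 1 = b)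
  * (mx2 a b c d 1 0 = c) * (mx2 a b c d 1 1 = d))%type.
Proof. by rewrite !mxE. Qed.

Lemma matrix2P (A B : 'M[K]_2) : A 0 0 = B 0 0 -> A 0 1 = B 0 1 ->
  A 1 0 = B 1 0 -> A 1 1 = B 1 1 -> A = B.
Proof.
move=> e1 e2 e3 e4; apply/matrixP => i j.
by case: (ord2P i) => ->; case: (ord2P j) => ->.
Qed.

Lemma mx2_eta (A : 'M[K]_2) : A = mx2 (A 0 0) (A 0 1) (A 1 0) (A 1 1).
Proof. by apply: matrix2P; rewrite mx2E. Qed.

Lemma mx2M a b c d a' b' c' d' : mx2 a b c d *m mx2 a' b' c' d' =
  mx2 (a * a' + b * c') (a * b' + b * d') (c * a' + d * c') (c * b' + d * d').
Proof. by apply: matrix2P; rewrite !mxE big_ord2 !mxE. Qed.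

Lemma mx2D a b c d a' b' c' d' : mx2 a b c d + mx2 a' b' c' d' =
  mx2 (a + a') (b + b') (c + c') (d + d').
Proof. by apply: matrix2P; rewrite !mxE. Qed.

Lemma mx2Z k a b c d : k *: mx2 a b c d = mx2 (k * a) (k * b) (k * c) (k * d).
Proof. by apply: matrix2P; rewrite !mxE. Qed.

Lemma mx2_tr a b c d : (mx2 a b c d)^T = mx2 a c b d.
Proof. by apply: matrix2P; rewrite !mxE. Qed.

Lemma mx2_1 : 1%:M = mx2 1 0 0 1.
Proof. by apply: matrix2P; rewrite !mxE. Qed.

Lemma mx2_det (A : 'M[K]_2) : \det A = A 0 0 * A 1 1 - A 0 1 * A 1 0.
Proof.
rewrite (expand_det_row _ 0) big_ord2 /cofactor !det_mx11 !mxE /=.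
rewrite !expr0 !mul1r.
have -> : lift 0 0 = 1 :> 'I_2 by apply: val_inj.
have -> : lift 1 0 = 0 :> 'I_2 by apply: val_inj.
by rewrite expr1; ring.
Qed.

Lemma mx2_trace (A : 'M[K]_2) : \tr A = A 0 0 + A 1 1.
Proof. by rewrite /mxtrace big_ord2. Qed.

End Mx2.

(** * Decomposing the products of Pauli coefficients *)

Section RealDecomposition.
Variable R : realFieldType.
Implicit Type p : 'I_4 -> R.

(* Row k lists the Pauli coefficients of 1/2 sum_i e_i - e_k, where e_i is the
   conjugation by the i-th Pauli matrix; this map is completely copositive. *)
Definition copauli (k i : 'I_4) : R := 2^-1 - (k == i)%:R.

(** Up to symmetry, one inequality for each of the three splittings of the indices into two
    pairs. *)
Definition pair_cond (p : 'I_4 -> R) := forall i j k l,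
  uniq [:: i; j; k; l] -> 0 <= p i * p j + p k * p l.

(** [t] holds the completely positive part and [s] the completely copositive one. *)
Definition pauli_decomp (p : 'I_4 -> R) := exists t s : 'I_4 -> 'I_4 -> R,
  [/\ forall i j, 0 <= t i j, forall k l, 0 <= s k l &
      forall i j, p i * p j =
        t i j + \sum_k \sum_l s k l * (copauli k i * copauli l j)].

Definition vec4 (a b c d : R) (i : 'I_4) :=
  match val i with 0%N => a | 1%N => b | 2%N => c | _ => d end.

(** All weights involve index 3: after sorting only the last coefficient can be negative, and row 3
    of [copauli] is the one that is negative there. *)
Definition mat4 s03 s13 s23 s33 (i j : 'I_4) : R :=
  match val i, val j with
  | 0%N, 3%N => s03 | 3%N, 0%N => s03
  | 1%N, 3%N => s13 | 3%N, 1%N => s13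
  | 2%N, 3%N => s23 | 3%N, 2%N => s23
  | 3%N, 3%N => s33 | _, _ => 0
  end.

Lemma mat4_ge0 s03 s13 s23 s33 i j : 0 <= s03 -> 0 <= s13 -> 0 <= s23 ->
  0 <= s33 -> 0 <= mat4 s03 s13 s23 s33 i j.
Proof.
by rewrite /mat4; case: (val i) => [|[|[|[|?]]]]; case: (val j) => [|[|[|[|?]]]].
Qed.

(* The vector (a, b, c, - e) is extreme for p0 p3 + p1 p2 >= 0, and the summand
   d (e_2 + e_3) is both completely positive and completely copositive. The
   witness s is a vertex of the corresponding linear program. *)
Lemma pauli_decomp_main a b c d e : 0 < a -> b <= a -> c <= b -> 0 <= d ->
  0 <= e -> e <= c -> a * e = b * c -> d <= e ->
  pauli_decomp (vec4 a b (c + d) (d - e)).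
Proof.
move=> a0 ba cb d0 e0 ec ae de.
(* [H] and [G] are the entries (0, 0) and (0, 1) of the remainder [t] chosen below, and c F + d (a -
   e) is its entry (0, 2). Up to symmetry and a e = b c, the other entries are sums of the products
   [P1] to [P7]. *)
have F : 0 <= a + e - b - c.
  rewrite -(pmulr_rge0 _ a0).
  have -> : a * (a + e - b - c) = (a - b) * (a - c) + (a * e - b * c) by ring.
  by rewrite ae subrr addr0; apply: mulr_ge0; lra.
have G : 0 <= a * b - 2 * (b * c) + c * e.
  rewrite -(pmulr_rge0 _ a0).
  have -> : a * (a * b - 2 * (b * c) + c * e) =
    b * (a - c) ^+ 2 + c * (a * e - b * c) by ring.
  by rewrite ae subrr mulr0 addr0; apply: mulr_ge0; [lra|apply: sqr_ge0].
have H : 0 <= a ^+ 2 - 2 * (b * c) - c ^+ 2 + 2 * (c * e).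
  have -> : a ^+ 2 - 2 * (b * c) - c ^+ 2 + 2 * (c * e) =
    (a - c) ^+ 2 + 2 * (c * (a + e - b - c)) by ring.
  by apply: addr_ge0; [apply: sqr_ge0|do 2 (apply: mulr_ge0; first lra)].
pose s := mat4 (2 * e * d) (2 * (c * (c - e)) + 2 * e * d)
               (2 * (c * (b - e))) (4 * (b * c)).
pose p := vec4 a b (c + d) (d - e).
(* With [t] defined as what [s] leaves over, the identity is automatic and only sixteen signs remain
   to be checked. *)
exists (fun i j => p i * p j -
   \sum_k \sum_l s k l * (copauli k i * copauli l j)), s; split; last first.
- by move=> i j; rewrite subrK.
- have ? : 0 <= 2 * e * d by do ?apply: mulr_ge0; lra.
  move=> k l; apply: mat4_ge0 => //.
  + by apply: addr_ge0 => //; do ?apply: mulr_ge0; lra.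
  + by do ?apply: mulr_ge0; lra.
  + by do ?apply: mulr_ge0; lra.
move=> i j; rewrite !big_ord_recl !big_ord0 /s /mat4 /copauli /p /vec4 /=.
rewrite -!val_eqE /=.
have F1 : 0 <= c * (a + e - b - c) by apply: mulr_ge0 => //; lra.
have P1 : 0 <= d * (a - e) by apply: mulr_ge0; lra.
have P2 : 0 <= d * (b - e) by apply: mulr_ge0; lra.
have P3 : 0 <= d * (c - e) by apply: mulr_ge0; lra.
have P4 : 0 <= d * d by apply: mulr_ge0; lra.
have P5 : 0 <= (b - c) * (b - c) by apply: mulr_ge0; lra.
have P6 : 0 <= (b - c) * (c - e) by apply: mulr_ge0; lra.
have P7 : 0 <= (c - e) * (c - e) by apply: mulr_ge0; lra.
clear s p F a0 ba cb d0 e0 ec de.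
by case: i => [[|[|[|[|//]]]] hi]; case: j => [[|[|[|[|//]]]] hj] /=; lra.
Qed.

Lemma pair_cond_vec4 a b c d :
  0 <= a * d + b * c -> 0 <= a * c + b * d -> 0 <= a * b + c * d ->
  pair_cond (vec4 a b c d).
Proof.
move=> h1 h2 h3; rewrite /pair_cond /vec4 => i j k l.
case: i => [[|[|[|[|//]]]] hi]; case: j => [[|[|[|[|//]]]] hj] //=;
  case: k => [[|[|[|[|//]]]] hk] //=; case: l => [[|[|[|[|//]]]] hl] //= _;
  rewrite ?[d * _]mulrC ?[c * a]mulrC ?[c * b]mulrC ?[b * a]mulrC //;
  by rewrite addrC.
Qed.

Lemma pauli_decomp_nonneg p : (forall i, 0 <= p i) -> pauli_decomp p.
Proof.
move=> p0; exists (fun i j => p i * p j), (fun _ _ => 0); split=> //.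
  by move=> i j; apply: mulr_ge0.
by move=> i j; rewrite !big1 ?addr0 // => k _; rewrite big1 // => l _; rewrite mul0r.
Qed.

Lemma eq_pauli_decomp p q : p =1 q -> pauli_decomp p -> pauli_decomp q.
Proof.
by move=> e [t [s [t0 s0 H]]]; exists t, s; split=> // i j; rewrite -!e.
Qed.

(** [copauli] is invariant under relabelling both arguments at once, so the two weight tables can be
    permuted with the coefficients. *)
Lemma pauli_decomp_perm p (f : {perm 'I_4}) :
  pauli_decomp (fun i => p (f i)) -> pauli_decomp p.
Proof.
case=> t [s [t0 s0 H]].
exists (fun i j => t (f^-1 i)%g (f^-1 j)%g), (fun i j => s (f^-1 i)%g (f^-1 j)%g).
split=> // i j.
have := H (f^-1 i)%g (f^-1 j)%g; rewrite !permKV => ->; congr (_ + _).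
rewrite [RHS](reindex_inj (@perm_inj _ f)) /=; apply: eq_bigr => k _.
rewrite [RHS](reindex_inj (@perm_inj _ f)) /=; apply: eq_bigr => l _.
rewrite !permK /copauli -(inj_eq (@perm_inj _ f) k) permKV.
by rewrite -(inj_eq (@perm_inj _ f) l) permKV.
Qed.

Lemma pauli_decomp_sorted (a b c e : R) : b <= a -> c <= b -> e <= c ->
  0 <= a * e + b * c -> 0 <= a * c + b * e -> 0 < a + b + c + e ->
  pauli_decomp (vec4 a b c e).
Proof.
move=> ba cb ec H1 H2 H3.
have [e0|e0] := lerP 0 e.
  apply: pauli_decomp_nonneg => i; rewrite /vec4.
  by case: (val i) => [|[|[|?]]]; lra.
have a0 : 0 < a by lra.
(* If c <= 0, the first inequality forces b < 0, and then - (a c + b e) = (a + e) (- b) + a (b - c)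
   is positive, against the second one. *)
have c0 : 0 < c.
  rewrite ltNge; apply/negP => c0.
  have ae : a * e < 0 by rewrite pmulr_rlt0.
  have b0 : b < 0.
    rewrite ltNge; apply/negP => b0.
    by have := mulr_ge0_le0 b0 c0; lra.
  have : 0 < (a + e) * (- b) by apply: mulr_gt0; lra.
  have : 0 <= a * (b - c) by apply: mulr_ge0; lra.
  by lra.
(* The shift of the last two coefficients that makes the first inequality an equality: a (e - d) + b
   (c - d) = 0. This produces the extreme vector of [pauli_decomp_main]. *)
pose d := (b * c + a * e) / (a + b).
have ab0 : 0 < a + b by lra.
have dE : d * (a + b) = b * c + a * e by rewrite divfK // gt_eqF.
have d0 : 0 <= d by apply: divr_ge0; lra.
have H4 : a * (d - e) = b * (c - d) by lra.
have c'0 : 0 <= c - d.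
  rewrite -(pmulr_lge0 _ ab0) mulrBl dE.
  have : 0 <= a * (c - e) by apply: mulr_ge0; lra.
  by lra.
have : pauli_decomp (vec4 a b ((c - d) + d) (d - (d - e))).
  apply: pauli_decomp_main => //; try lra.
  rewrite -(ler_pM2l a0) H4; apply: ler_wpM2r => //.
by rewrite subrK opprB addrC subrK.
Qed.

Lemma pauli_decompP p : pair_cond p -> 0 < \sum_i p i -> pauli_decomp p.
Proof.
move=> pp p0.
pose r : rel R := fun x y => y <= x.
(* Sorting the values in decreasing order is read as a permutation of the indices, under which
   hypothesis and conclusion are invariant. *)
have /tuple_permP [f ef] : perm_eq (sort r (codom p)) [tuple p i | i < 4].
  by rewrite perm_sort.
apply: (@pauli_decomp_perm p f).
have srt : sorted r (sort r (codom p)).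
  by apply: sort_sorted => x y; rewrite /r le_total.
pose o k (lt : (k < 4)%N) := Ordinal lt.
have [o0 o1 o2 o3] : [/\ 0 < 4, 1 < 4, 2 < 4 & 3 < 4]%N by [].
pose q (i : 'I_4) := p (f i).
apply: (@eq_pauli_decomp (vec4 (q (o _ o0)) (q (o _ o1)) (q (o _ o2)) (q (o _ o3)))).
  by move=> [[|[|[|[|//]]]] hi]; rewrite /vec4 /q /=; congr (p (f _)); apply: val_inj.
have : sorted r [:: q (o _ o0); q (o _ o1); q (o _ o2); q (o _ o3)].
  move: srt; rewrite ef; congr (sorted r _).
  apply: (@eq_from_nth _ 0); rewrite ?size_tuple // => n hn.
  rewrite -[n]/(val (Ordinal hn)) -(tnth_nth 0) !tnth_mktuple -/(q _).
  by case: n hn => [|[|[|[|//]]]] hn /=; congr (q _); apply: val_inj.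
rewrite /= andbT => /and3P [h1 h2 h3].
have uf i j k l : uniq [:: i; j; k; l] -> 0 <= q i * q j + q k * q l.
  by move=> u; apply: pp; rewrite -(map_inj_uniq (@perm_inj _ f)) in u.
apply: pauli_decomp_sorted => //.
- by apply: uf.
- by apply: uf.
have : \sum_i p i = \sum_i q i by rewrite (reindex_inj (@perm_inj _ f)).
move: p0 => /[swap] ->.
rewrite !big_ord_recl big_ord0 addr0 !addrA; congr (0 < _).
by congr (_ + _ + _ + _); congr (q _); apply: val_inj.
Qed.
End RealDecomposition.

(** * Pauli conjugations and their transposes *)

Section PauliMaps.
Variable C : numClosedFieldType.

(** The weights are arbitrary scalars, so signed combinations of conjugations are included;
    nonnegative weights give a Kraus form in the usual sense. *)
Definition kraus (I : finType) m n (a : I -> C) (K : I -> 'M[C]_(m, n))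
  (X : 'M[C]_n) : 'M[C]_m := \sum_i a i *: conjg_mx (K i) X.

Lemma kraus_is_linear (I : finType) m n a (K : I -> 'M[C]_(m, n)) :
  linear (kraus a K).
Proof.
move=> c X Y; rewrite /kraus scaler_sumr -big_split; apply: eq_bigr => i _ /=.
by rewrite linearP scalerDr !scalerA mulrC.
Qed.
HB.instance Definition _ (I : finType) m n a (K : I -> 'M[C]_(m, n)) :=
  GRing.isLinear.Build C 'M[C]_n 'M[C]_m _ (kraus a K) (kraus_is_linear a K).

Lemma cp_kraus (I : finType) m n a (K : I -> 'M[C]_(m, n)) :
  (forall i, 0 <= a i) -> completely_positive (kraus a K).
Proof.
move=> a0; apply: cp_sum => i; apply: (cpZ (L := conjg_mx (K i))) => //.
exact: cp_conjg.
Qed.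

Lemma tensmap_kraus (I J : finType) m n p q a (K : I -> 'M[C]_(m, n))
    b (L : J -> 'M[C]_(p, q)) X :
  tensmap (kraus a K) (kraus b L) X =
  \sum_i \sum_j (a i * b j) *: conjg_mx (K i *t L j) X.
Proof.
rewrite tensmap_suml; apply: eq_bigr => i _.
rewrite tensmapZl tensmap_sumr scaler_sumr; apply: eq_bigr => j _.
by rewrite tensmapZr tensmap_conjg scalerA.
Qed.

Definition pauli (k : 'I_4) : 'M[C]_2 :=
  match val k with
  | 0%N => mx2 1 0 0 1 | 1%N => mx2 0 1 1 0
  | 2%N => mx2 0 (- 'i) 'i 0 | _ => mx2 1 0 0 (- 1)
  end.

(** The product of the Pauli matrices 2 and k, up to a phase. Row 2 of [copauli] is transposition
    itself, and composing it with the conjugation by this product gives row k. *)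
Definition copauli_index (k : 'I_4) : 'I_4 :=
  match val k with 0%N => 2%:R | 1%N => 3%:R | 2%N => 0 | _ => 1 end.

Lemma adjmx_mx2 (a b c d : C) : adjmx (mx2 a b c d) = mx2 a^* c^* b^* d^*.
Proof. by apply: matrix2P; rewrite adjmxE !mx2E. Qed.

Lemma kraus_copauli (R : realFieldType) (f : {rmorphism R -> C}) k X :
  kraus (fun i => f (copauli R k i)) pauli X =
  (conjg_mx (pauli (copauli_index k)) X)^T.
Proof.
rewrite [X]mx2_eta; move: (X 0 0) (X 0 1) (X 1 0) (X 1 1) => x y z w.
rewrite /kraus !big_ord_recl big_ord0 /copauli !rmorphB fmorphV !rmorph_nat.
rewrite /conjg_mx -!val_eqE.
case: k => [[|[|[|[|//]]]] hk]; rewrite /pauli /= ?(adjmx_mx2, mx2M).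
all: rewrite !rmorphN /= ?conjC0 ?conjC1 ?conjCi ?mx2_tr ?addr0 ?mx2Z ?mx2D.
all: have ii : 'i * 'i = -1 :> C by rewrite -expr2 sqrCi.
all: by apply: matrix2P; rewrite !mx2E; field: ii.
Qed.

Lemma pauli_decomposable (R : realFieldType) (f : {rmorphism R -> C})
    (p : 'I_4 -> R) :
  (forall x, 0 <= x -> 0 <= f x) -> pair_cond p -> 0 < \sum_i p i ->
  decomposable (tensmap (kraus (fun i => f (p i)) pauli)
                        (kraus (fun i => f (p i)) pauli)).
Proof.
move=> f0 pp p0; have [t [s [t0 s0 H]]] := pauli_decompP pp p0.
pose K (ij : 'I_4 * 'I_4) := pauli ij.1 *t pauli ij.2.
pose L (kl : 'I_4 * 'I_4) :=
  pauli (copauli_index kl.1) *t pauli (copauli_index kl.2).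
exists [the {linear _ -> _} of kraus (fun ij => f (t ij.1 ij.2)) K].
exists [the {linear _ -> _} of kraus (fun kl => f (s kl.1 kl.2)) L].
split; first by apply: cp_kraus => ij; apply: f0.
split; first by apply: cp_kraus => ij; apply: f0.
move=> X; rewrite tensmap_kraus.
pose G i j := conjg_mx (pauli i *t pauli j) X.
transitivity (\sum_i \sum_j f (t i j) *: G i j + \sum_i \sum_j
   \sum_k \sum_l (f (s k l) * (f (copauli R k i) * f (copauli R l j))) *: G i j).
  rewrite -big_split; apply: eq_bigr => i _ /=.
  rewrite -big_split; apply: eq_bigr => j _ /=.
  rewrite -rmorphM H rmorphD scalerDl rmorph_sum scaler_suml; congr (_ + _).
  apply: eq_bigr => k _; rewrite rmorph_sum scaler_suml; apply: eq_bigr => l _.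
  by rewrite !rmorphM.
congr (_ + _); first by rewrite pair_big.
under eq_bigr => i _ do rewrite exchange_big.
rewrite exchange_big /= linear_sum.
rewrite -(pair_bigA _ (fun k l => (f (s k l) *: conjg_mx (L (k, l)) X)^T)) /=.
apply: eq_bigr => k _.
transitivity (\sum_i \sum_l \sum_j
    (f (s k l) * (f (copauli R k i) * f (copauli R l j))) *: G i j).
  by apply: eq_bigr => i _; rewrite exchange_big.
rewrite exchange_big; apply: eq_bigr => l _ /=.
transitivity (f (s k l) *: tensmap (kraus (fun i => f (copauli R k i)) pauli)
   (kraus (fun i => f (copauli R l i)) pauli) X).
  rewrite tensmap_kraus scaler_sumr; apply: eq_bigr => i _.
  by rewrite scaler_sumr; apply: eq_bigr => j _; rewrite scalerA.
(* Each factor is a transposed conjugation, and transposing both tensor factors transposes the whole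
   matrix. *)
rewrite (eq_tensmap (kraus_copauli f k) (kraus_copauli f l)) tensmap_trmx.
by rewrite tensmap_conjg linearZ.
Qed.
End PauliMaps.

(** * Invariance of the problem under invertible conjugations *)

Section TensorSquare.
Variable C : numClosedFieldType.

(** The hard implication as a property of P, so that it can be transported along normalizations of
    P. *)
Definition square_decomposable d1 d2 (P : 'M[C]_d1 -> 'M[C]_d2) :=
  positive_map (tensmap P P) -> decomposable (tensmap P P).

Lemma eq_square_decomposable d1 d2 (P Q : 'M[C]_d1 -> 'M[C]_d2) :
  P =1 Q -> square_decomposable P -> square_decomposable Q.
Proof.
move=> e sP pQ; have eT := eq_tensmap e e; apply: (eq_decomposable eT).
by apply: sP; apply: eq_positive pQ => X; rewrite eT.
Qed.

Lemma conjg_mx_inv n (K : 'M[C]_n) X : K \in unitmx ->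
  conjg_mx (invmx K) (conjg_mx K X) = X.
Proof.
move=> uK; rewrite /conjg_mx adjmx_inv !mulmxA mulVmx // mul1mx.
by rewrite mulmxK // adjmx_unit.
Qed.

Lemma tensmap_conjg_comp n m (P : {linear 'M[C]_n -> 'M[C]_m}) A B :
  tensmap (fun X => conjg_mx B (P (conjg_mx A X)))
          (fun X => conjg_mx B (P (conjg_mx A X))) =1
  (fun X => @conjg_mx C (m * m) (m * m) (B *t B)
     (tensmap P P (@conjg_mx C (n * n) (n * n) (A *t A) X))).
Proof.
move=> X; rewrite -tensmap_conjg -(tensmap_conjg A) !tensmap_comp.
exact: eq_tensmap.
Qed.

(** Positivity passes to the conjugated map and decomposability comes back through the inverse
    conjugations: on the tensor square these are conjugations by A (x) A and B (x) B, which preserve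
    both properties. *)
Lemma square_decomposable_conjg n m (P : {linear 'M[C]_n -> 'M[C]_m}) A B :
  A \in unitmx -> B \in unitmx ->
  square_decomposable (fun X => conjg_mx B (P (conjg_mx A X))) ->
  square_decomposable P.
Proof.
move=> uA uB sP pP.
have eP : (fun X => conjg_mx (invmx B) (conjg_mx B
    (P (conjg_mx A (conjg_mx (invmx A) X))))) =1 P.
  move=> X; rewrite conjg_mx_inv // -{1}[A]invmxK conjg_mx_inv //.
  by rewrite unitmx_inv.
apply: (eq_decomposable (eq_tensmap eP eP)).
pose Q := [the {linear 'M[C]_n -> 'M[C]_m} of conjg_mx B \o P \o conjg_mx A].
apply: (eq_decomposable (fsym (tensmap_conjg_comp Q (invmx A) (invmx B)))).
apply: decomposable_conjg; apply: sP.
apply: (eq_positive (fsym (tensmap_conjg_comp P A B))).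
apply: positive_comp; first exact: positive_conjg.
apply: positive_comp => //; exact: positive_conjg.
Qed.

End TensorSquare.

(** * Maps that are diagonal in the Pauli basis *)

Section Diagonal.
Local Open Scope complex_scope.
Variable R : realType.
Local Notation C := (R[i]).

Lemma conjcE (z : C) : Num.conj z = conjc z. Proof. by []. Qed.

(** This map fixes 1 and multiplies the Pauli matrices x, y and z by al + be, al - be and c. *)
Definition xmap (c al be : C) (X : 'M[C]_2) : 'M[C]_2 :=
  mx2 ((1 + c) / 2 * X 0 0 + (1 - c) / 2 * X 1 1)
      (al * X 0 1 + be * X 1 0) (be * X 0 1 + al * X 1 0)
      ((1 - c) / 2 * X 0 0 + (1 + c) / 2 * X 1 1).

(** Each e_i acts on the Pauli basis by signs, a character of the Klein four-group; the weights are
    the inverse transform of the multipliers 1, a, b, c. *)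
Lemma xmap_kraus (c a b : R) (p := vec4 ((1 + a + b + c) / 4)
    ((1 + a - b - c) / 4) ((1 - a + b - c) / 4) ((1 - a - b + c) / 4)) X :
  xmap c%:C ((a + b) / 2)%:C ((a - b) / 2)%:C X =
  kraus (fun i => (p i)%:C) (@pauli C) X.
Proof.
rewrite {2}[X]mx2_eta /xmap; move: (X 0 0) (X 0 1) (X 1 0) (X 1 1) => x y z w.
rewrite /kraus !big_ord_recl big_ord0 /p /vec4 /pauli /conjg_mx /=.
rewrite ?(adjmx_mx2, mx2M) !rmorphN /= ?conjC0 ?conjC1 ?conjCi ?addr0 ?mx2Z ?mx2D.
have ii : 'i%R * 'i%R = -1 :> C by rewrite -expr2 sqrCi.
rewrite !fmorph_div !(rmorphD, rmorphB, rmorph1, rmorph_nat) /=.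
by apply: matrix2P; rewrite !mx2E; field: ii.
Qed.

Lemma xmap_is_linear c al be : linear (xmap c al be).
Proof.
move=> k X Y; rewrite /xmap mx2Z mx2D.
by apply: matrix2P; rewrite !mx2E !mxE; ring.
Qed.
HB.instance Definition _ c al be :=
  GRing.isLinear.Build C 'M[C]_2 'M[C]_2 _ (xmap c al be)
    (xmap_is_linear c al be).

Lemma xmap_square_decomposable (c a b : R) :
  square_decomposable (xmap c%:C ((a + b) / 2)%:C ((a - b) / 2)%:C).
Proof.
move al_def: ((a + b) / 2) => al; move be_def: ((a - b) / 2) => be pP.
pose P := [the {linear 'M[C]_2 -> 'M[C]_2} of xmap c%:C al%:C be%:C].
pose M := tensmap P P (choi_id C 2).
have pM : psd M by apply: pP; apply: psd_choi_id.
have ME i j k l : M (mxtens_index (i, k)) (mxtens_index (j, l)) =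
    \sum_x \sum_y P (delta_mx x y) i j * P (delta_mx x y) k l.
  rewrite /M /choi_id linear_sum summxE; apply: eq_bigr => x _.
  rewrite linear_sum summxE; apply: eq_bigr => y _.
  by rewrite -tensmxE -tensmap_tens.
have real1 (x : R) : Num.conj x%:C = x%:C by rewrite conjcE conjc_real.
have delta2 (i j : 'I_2) : delta_mx i j = mx2 ((i == 0) && (j == 0))%:R
    ((i == 0) && (j == 1))%:R ((i == 1) && (j == 0))%:R
    ((i == 1) && (j == 1))%:R :> 'M[C]_2.
  apply: matrix2P; rewrite mx2E mxE /= ?[0 == _]eq_sym ?[1 == _]eq_sym //;
    by rewrite [_ == i]eq_sym [_ == j]eq_sym.
have P00 : P (delta_mx 0 0) = mx2 ((1 + c%:C) / 2) 0 0 ((1 - c%:C) / 2).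
  by rewrite delta2 /P /= /xmap !mx2E /= !(mulr0, mulr1, addr0).
have P11 : P (delta_mx 1 1) = mx2 ((1 - c%:C) / 2) 0 0 ((1 + c%:C) / 2).
  by rewrite delta2 /P /= /xmap !mx2E /= !(mulr0, mulr1, addr0, add0r).
have P01 : P (delta_mx 0 1) = mx2 0 al%:C be%:C 0.
  by rewrite delta2 /P /= /xmap !mx2E /= !(mulr0, mulr1, addr0, add0r).
have P10 : P (delta_mx 1 0) = mx2 0 be%:C al%:C 0.
  by rewrite delta2 /P /= /xmap !mx2E /= !(mulr0, mulr1, addr0, add0r).
have PE := (P00, P01, P10, P11).
(* The image of the maximally entangled state is tested on e_00 + e e_11 here, and on e_01 + e e_10
   in [q2]. *)
have q1 (e : R) : 0 <= (1 + c ^+ 2) / 2 * (1 + e ^+ 2) + 2 * (al ^+ 2 + be ^+ 2) * e.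
  rewrite -ler0c !(rmorphD, rmorphM, rmorphXn, fmorphV, rmorph_nat, rmorph1) /=.
  have := psd_pair (mxtens_index (0, 0)) (mxtens_index (1, 1)) e%:C pM.
  by rewrite real1 !ME !big_ord2 !PE !mx2E; congr (0 <= _); field.
have q2 (e : R) : 0 <= (1 - c ^+ 2) / 2 * (1 + e ^+ 2) + 4 * (al * be) * e.
  rewrite -ler0c !(rmorphD, rmorphB, rmorphM, rmorphXn, fmorphV, rmorph_nat, rmorph1) /=.
  have := psd_pair (mxtens_index (0, 1)) (mxtens_index (1, 0)) e%:C pM.
  by rewrite real1 !ME !big_ord2 !PE !mx2E; congr (0 <= _); field.
(* At e = 1 and e = -1 the test vectors are Bell vectors; these three values are 8 times the three
   pair sums of the weights. *)
have e1 := q1 (-1); have e2 := q2 1; have e3 := q2 (-1).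
rewrite -al_def -be_def in e1 e2 e3 *.
have eP := fsym (xmap_kraus c a b).
apply: (eq_decomposable (eq_tensmap eP eP)).
apply: (pauli_decomposable (f := real_complex R)).
- by move=> x; rewrite ler0c.
- by apply: pair_cond_vec4; lra.
by rewrite !big_ord_recl big_ord0 /vec4 /=; lra.
Qed.
End Diagonal.

(** * Removing phases with diagonal unitaries *)

Section Phases.
Variable C : numClosedFieldType.

Lemma phase_ex (z : C) : exists2 g : C, g * g^* = 1 & z = `|z| * g.
Proof.
have [-> | z0] := eqVneq z 0; first by exists 1; rewrite ?conjC1 ?normr0 ?mul0r ?mulr1.
have n0 : `|z| != 0 by rewrite normr_eq0.
exists (z / `|z|); last by rewrite mulrC divfK.
rewrite rmorphM fmorphV /= (geC0_conj (normr_ge0 z)) mulrACA -normCK -invfM -expr2.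
by rewrite divff // expf_neq0.
Qed.

Lemma common_phase (al be : C) : exists g h : C, [/\ g * g^* = 1,
  h * h^* = 1, h * g * al \is Num.real & h^* * g * be \is Num.real].
Proof.
have [p pp ep] := phase_ex al; have [q qq eq] := phase_ex be.
have sqrt_unit (z : C) : z * z^* = 1 -> sqrtC z * (sqrtC z)^* = 1.
  move=> zz; rewrite -normCK.
  have : (`|sqrtC z| ^+ 2) ^+ 2 = 1 ^+ 2 by rewrite expr1n -normrX sqrtCK normCK.
  by move/pexpIrn => ->; rewrite ?nnegrE ?exprn_ge0.
(* Here g^2 is the conjugate of p q, so that h g p = 1 and conj(h) g q = 1 hold together. *)
pose g := sqrtC (p * q)^*; pose h := (g * p)^*.
have gg : g * g^* = 1.
  apply: sqrt_unit; rewrite !rmorphM /= !conjCK mulrACA.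
  by rewrite [_ * p]mulrC pp [_ * q]mulrC qq mulr1.
have g2 : g * g = (p * q)^* by rewrite -expr2 sqrtCK.
exists g, h; split=> //.
- by rewrite /h conjCK mulrC rmorphM mulrACA gg pp mulr1.
- rewrite ep mulrCA; apply: rpredM; first exact: normr_real.
  have -> : h * g * p = (g * g^*) * (p * p^*) by rewrite /h rmorphM /=; ring.
  by rewrite gg pp mulr1 real1.
rewrite eq mulrCA; apply: rpredM; first exact: normr_real.
have -> : h^* * g * q = (g * g) * (p * q) by rewrite /h conjCK; ring.
rewrite g2 rmorphM /=.
have -> : p^* * q^* * (p * q) = (p * p^*) * (q * q^*) by ring.
by rewrite pp qq mulr1 real1.
Qed.

End Phases.

Section DiagonalForm.
Local Open Scope complex_scope.
Variable R : realType.
Local Notation C := (R[i]).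

Lemma mx2_unit (a b c d : C) : a * d - b * c != 0 -> mx2 a b c d \in unitmx.
Proof. by rewrite unitmxE mx2_det !mx2E unitfE. Qed.

Lemma conjg_diag (g : C) X : g * Num.conj g = 1 ->
  conjg_mx (mx2 g 0 0 1) X = mx2 (X 0 0) (g * X 0 1) (Num.conj g * X 1 0) (X 1 1).
Proof.
move=> gg; rewrite {1}[X]mx2_eta; move: (X 0 0) (X 0 1) (X 1 0) (X 1 1) => x y z w.
rewrite /conjg_mx adjmx_mx2 !mx2M conjC0 conjC1.
by apply: matrix2P; rewrite !mx2E; ring: gg.
Qed.

(** Conjugating by diag(g, 1) before P and diag(h, 1) after it multiplies al by h g and be by
    conj(h) g; [common_phase] makes both products real. *)
Lemma square_decomposable_xform (P : {linear 'M[C]_2 -> 'M[C]_2}) (c : R) (al be : C) :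
  (forall X, P X = mx2 ((1 + c%:C) / 2 * X 0 0 + (1 - c%:C) / 2 * X 1 1)
      (al * X 0 1 + Num.conj be * X 1 0) (be * X 0 1 + Num.conj al * X 1 0)
      ((1 - c%:C) / 2 * X 0 0 + (1 + c%:C) / 2 * X 1 1)) ->
  square_decomposable P.
Proof.
move=> PE; have [g [h [gg hh r1 r2]]] := common_phase al be.
have u (k : C) : k * Num.conj k = 1 -> mx2 k 0 0 1 \in unitmx.
  move=> kk; apply: (mx2_unit (a := k)); rewrite mulr1 mulr0 subr0.
  by apply: contra_eq_neq kk => ->; rewrite mul0r eq_sym oner_eq0.
apply: (square_decomposable_conjg (u _ gg) (u _ hh)).
have [[x xE] [y yE]] := (complex_realP _ r1, complex_realP _ r2).
apply: (eq_square_decomposable _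
  (xmap_square_decomposable (c := c) (a := x + y) (b := x - y))).
move=> X; rewrite !conjg_diag // PE !mx2E /xmap.
have -> : (x + y + (x - y)) / 2 = x by field.
have -> : (x + y - (x - y)) / 2 = y by field.
rewrite -xE -yE.
have xE' := CrealP r1; have yE' := CrealP r2.
rewrite !rmorphM /= ?conjCK in xE' yE'.
by apply: matrix2P; rewrite !mx2E //; [rewrite -yE' | rewrite -xE']; ring.
Qed.

End DiagonalForm.

(** * A pair of singular vectors of a real matrix of odd size *)

Section SingularPair.
Variable R : rcfType.

Definition dot n (v w : 'rV[R]_n) : R := (v *m w^T) 0 0.

Lemma dotE n (v w : 'rV[R]_n) : dot v w = \sum_i v 0 i * w 0 i.
Proof. by rewrite /dot mxE; apply: eq_bigr => i _; rewrite mxE. Qed.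

Lemma dot_gt0 n (v : 'rV[R]_n) : v != 0 -> 0 < dot v v.
Proof.
move=> v0; rewrite lt_neqAle; apply/andP; split; last first.
  by rewrite dotE sumr_ge0 // => i _; rewrite -expr2 sqr_ge0.
rewrite eq_sym; apply: contra v0; rewrite dotE psumr_eq0; last first.
  by move=> i _; rewrite -expr2 sqr_ge0.
move=> /allP H; apply/eqP/rowP => i; rewrite mxE; apply/eqP.
by have := H i (mem_index_enum _); rewrite /= mulf_eq0 orbb.
Qed.

Lemma dotZl n a (v w : 'rV[R]_n) : dot (a *: v) w = a * dot v w.
Proof. by rewrite /dot -scalemxAl mxE. Qed.

Lemma dotZr n a (v w : 'rV[R]_n) : dot v (a *: w) = a * dot v w.
Proof. by rewrite /dot linearZ -scalemxAr mxE. Qed.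

Lemma dotM n m (v : 'rV[R]_n) (w : 'rV[R]_m) A :
  dot (v *m A) w = dot v (w *m A^T).
Proof. by rewrite /dot trmx_mul trmxK mulmxA. Qed.

Lemma unit_vector n (v : 'rV[R]_n) : v != 0 ->
  exists2 a : R, 0 < a & dot (a *: v) (a *: v) = 1.
Proof.
move=> /dot_gt0 d0; exists (Num.sqrt (dot v v))^-1; first by rewrite invr_gt0 sqrtr_gt0.
rewrite dotZl dotZr mulrA -invfM -expr2 sqr_sqrtr ?ltW // mulVf ?gt_eqF //.
Qed.

Lemma odd_eigenvalue n (A : 'M[R]_n) : odd n -> exists a, eigenvalue A a.
Proof.
move=> on; have [|x rx] := @odd_poly_root R (char_poly A).
  by rewrite size_char_poly /= negbK.
by exists x; rewrite eigenvalue_root_char.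
Qed.

(** A real eigenvalue of A A^T suffices for one pair, and its characteristic polynomial has odd
    degree. If v A = 0, then c = 0 and w comes from the left kernel of A^T. *)
Lemma singular_pair n (A : 'M[R]_n) : odd n -> exists v w c,
  [/\ dot v v = 1, dot w w = 1, v *m A = c *: w & w *m A^T = c *: v].
Proof.
move=> on; have [a /eigenvalueP [v va v0]] := odd_eigenvalue (A *m A^T) on.
rewrite mulmxA in va.
have [b b0 bb] := unit_vector v0.
have [vA0|vA0] := eqVneq (v *m A) 0.
  have dA : \det A^T == 0.
    rewrite det_tr; apply/det0P; exists v => //.
  have [w w0 wA] := det0P dA.
  have [d d0 dd] := unit_vector w0.
  exists (b *: v), (d *: w), 0; split=> //.
    by rewrite -scalemxAl vA0 scaler0 scale0r.
  by rewrite -scalemxAl wA scaler0 scale0r.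
have [d d0 dd] := unit_vector vA0.
exists (b *: v), (d *: (v *m A)), (b / d); split=> //.
  by rewrite -scalemxAl scalerA divfK // gt_eqF.
rewrite -scalemxAl va !scalerA; congr (_ *: _).
have : a * dot v v = dot (v *m A) (v *m A) by rewrite dotM va dotZr.
move: bb dd; rewrite !dotZl !dotZr => b1 d1 e; rewrite -e in d1.
have n0 : dot v v != 0 by rewrite gt_eqF // dot_gt0.
have dn0 : d != 0 by rewrite gt_eqF.
apply: (mulIf n0); apply: (mulfI dn0).
have -> : d * (d * a * dot v v) = 1 by rewrite -d1; ring.
by rewrite -b1; field.
Qed.

End SingularPair.

(** * Unital trace-preserving maps in the Bloch representation *)

Section UnitalTracePreserving.
Local Open Scope complex_scope.
Variable R : realType.
Local Notation C := (R[i]).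
Implicit Type P : {linear 'M[C]_2 -> 'M[C]_2}.

Definition pauliZ : 'M[C]_2 := mx2 1 0 0 (- 1).

(** Since Z is an eigenvector of both P and its trace adjoint, the off-diagonal matrices are
    invariant; on them, preserving adjoints leaves just the two parameters al and be. *)
Lemma square_decomposable_pauliZ P (c : R) :
  (forall X, P (adjmx X) = adjmx (P X)) -> P 1%:M = 1%:M ->
  P pauliZ = c%:C *: pauliZ ->
  (forall X, \tr (P X) = \tr X) ->
  (forall X, \tr (pauliZ *m P X) = c%:C * \tr (pauliZ *m X)) ->
  square_decomposable P.
Proof.
move=> hP P1 PZ trP trZP.
pose E := mx2 0 1 0 0 : 'M[C]_2.
pose al := P E 0 1; pose be := P E 1 0.
have PE : P E = mx2 0 al be 0.
  have := trP E; have := trZP E; rewrite !mx2_trace /pauliZ.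
  rewrite [P E]mx2_eta -/al -/be /E !mx2M !mx2E.
  rewrite !(mul1r, mul0r, mulr0, mulN1r, addr0, add0r, subr0) => e1 e2.
  have e3 : P E 0 0 = P E 1 1 by apply/eqP; rewrite -subr_eq0 e1.
  rewrite e3 in e2 *; have -> : P E 1 1 = 0.
    by move/eqP: e2; rewrite -mulr2n -mulr_natr mulf_eq0 pnatr_eq0 orbF => /eqP.
  by [].
have PEt : P (mx2 0 0 1 0) = mx2 0 (Num.conj be) (Num.conj al) 0.
  have -> : mx2 0 0 1 0 = adjmx E by rewrite adjmx_mx2 !conjC0 conjC1.
  by rewrite hP PE adjmx_mx2 !conjC0.
apply: (@square_decomposable_xform R P c al be) => X.
have -> : P X = ((X 0 0 + X 1 1) / 2) *: P 1%:M + ((X 0 0 - X 1 1) / 2) *: P pauliZ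
  + X 0 1 *: P E + X 1 0 *: P (mx2 0 0 1 0).
  by rewrite -!linearZ -!linearD; congr (P _); apply: matrix2P;
    rewrite mx2_1 !mx2Z !mx2D !mx2E; field.
by rewrite P1 PZ PE PEt mx2_1 !mx2Z !mx2D; apply: matrix2P; rewrite !mx2E; field.
Qed.

Definition bloch (v : 'rV[R]_3) : 'M[C]_2 :=
  mx2 (v 0 2)%:C (v 0 0 -i* v 0 1) (v 0 0 +i* v 0 1) (- v 0 2)%:C.

Lemma complex_split (x y : R) : x +i* y = x%:C + 'i%R * y%:C.
Proof. by rewrite -complexiE; simpc. Qed.

Lemma blochZ a v : bloch (a *: v) = a%:C *: bloch v.
Proof.
rewrite /bloch mx2Z !mxE; apply: matrix2P; rewrite !mx2E; simpc => //.
Qed.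

Lemma blochD v w : bloch (v + w) = bloch v + bloch w.
Proof.
rewrite /bloch mx2D !mxE; apply: matrix2P; rewrite !mx2E; simpc => //;
  by rewrite -?opprD.
Qed.

Lemma adj_bloch v : adjmx (bloch v) = bloch v.
Proof.
rewrite /bloch adjmx_mx2 !conjcE; apply: matrix2P; rewrite !mx2E; simpc => //.
Qed.

Lemma tr_bloch v : \tr (bloch v) = 0.
Proof. by rewrite mx2_trace !mx2E rmorphN subrr. Qed.

Lemma big_ord3 (V : nmodType) (F : 'I_3 -> V) : \sum_i F i = F 0 + F 1 + F 2.
Proof.
rewrite !big_ord_recl big_ord0 addr0 addrA.
by congr (_ + F _ + F _); apply: val_inj.
Qed.

Lemma tr_blochM v w : \tr (bloch v *m bloch w) = (2 * dot v w)%:C.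
Proof.
rewrite mx2_trace mx2M !mx2E dotE big_ord3 !complex_split.
rewrite !(rmorphN, rmorphD, rmorphM, rmorph_nat) /=.
have ii : 'i%R * 'i%R = -1 :> C by rewrite -expr2 sqrCi.
by ring: ii.
Qed.

Lemma conjg_mx1 (U : 'M[C]_2) : U *m adjmx U = 1%:M -> conjg_mx U 1%:M = 1%:M.
Proof. by rewrite /conjg_mx mulmx1. Qed.

(** The unitary is (bloch v + Z) / |v + e_z|, the half turn about the bisector of v and the z axis,
    with |v + e_z|^2 = 2 + 2 z. At z = -1 there is no bisector, and the Pauli matrix x does the
    job. *)
Lemma bloch_unitary v : dot v v = 1 ->
  exists2 U, U *m adjmx U = 1%:M & conjg_mx U pauliZ = bloch v.
Proof.
rewrite dotE big_ord3; set x := v 0 0; set y := v 0 1; set z := v 0 2 => n1.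
have ii : 'i%R * 'i%R = -1 :> C by rewrite -expr2 sqrCi.
have [z1|z1] := eqVneq z (-1).
  have y2 : y * y + x * x = 0 by rewrite z1 in n1; lra.
  have x0 : x = 0 by nra.
  have y0 : y = 0 by nra.
  exists (mx2 0 1 1 0); rewrite ?/conjg_mx adjmx_mx2 !conjC0 conjC1 ?mx2_1 !mx2M.
    by apply: matrix2P; rewrite !mx2E; ring.
  rewrite /bloch -/x -/y -/z x0 y0 z1; apply: matrix2P; rewrite !mx2E; simpc => //; ring.
have z0 : 0 < 2 + 2 * z.
  have zm : -1 <= z by nra.
  have : -1 < z by rewrite lt_neqAle eq_sym z1.
  by lra.
pose s := Num.sqrt (2 + 2 * z).
have s0 : s != 0 by rewrite gt_eqF // sqrtr_gt0.
have ss : s%:C * s%:C = 2 + 2 * z%:C.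
  by rewrite -rmorphM -expr2 sqr_sqrtr ?ltW // rmorphD rmorphM rmorph_nat.
have sC0 : s%:C != 0 by rewrite fmorph_eq0.
pose U := mx2 (1 + z)%:C (x -i* y) (x +i* y) (- (1 + z))%:C.
have n1C : x%:C * x%:C = 1 - y%:C * y%:C - z%:C * z%:C.
  by rewrite -!rmorphM -(rmorph1 (real_complex R)) -!rmorphB -n1; congr _%:C; ring.
have aU : adjmx (s%:C^-1 *: U) = s%:C^-1 *: U.
  rewrite adjmxZ fmorphV /= conjcE conjc_real; congr (_ *: _).
  rewrite /U adjmx_mx2 !conjcE; apply: matrix2P; rewrite !mx2E; simpc => //.
have UE : U = mx2 (1 + z%:C) (x%:C - 'i%R * y%:C) (x%:C + 'i%R * y%:C) (- (1 + z%:C)).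
  by rewrite /U !complex_split !(rmorphN, rmorphD, rmorph1) /= mulrN.
have sI (A B : 'M[C]_2) : A = (2 + 2 * z%:C) *: B -> (s%:C^-1 * s%:C^-1) *: A = B.
  move=> ->; rewrite scalerA -ss (_ : _ * _ = 1) ?scale1r //; by field.
exists (s%:C^-1 *: U); rewrite /conjg_mx aU -!scalemxAl -!scalemxAr scalerA;
    apply: sI.
  rewrite mx2_1 mx2Z UE mx2M.
  by apply: matrix2P; rewrite !mx2E; ring: n1C ii.
rewrite /bloch -/x -/y -/z mx2Z UE !mx2M !complex_split !rmorphN /=.
by apply: matrix2P; rewrite !mx2E; ring: n1C ii.
Qed.

Definition unbloch (X : 'M[C]_2) : 'rV[R]_3 :=
  \row_j (if j == 0 then complex.Re (X 1 0)
    else if j == 1 then complex.Im (X 1 0) else complex.Re (X 0 0)).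

Lemma unblochK X : adjmx X = X -> \tr X = 0 -> bloch (unbloch X) = X.
Proof.
move=> hX; rewrite mx2_trace => /eqP; rewrite addr_eq0 => /eqP tX.
have r00 : X 0 0 = (complex.Re (X 0 0))%:C.
  by apply/esym/RRe_real/CrealP; rewrite -adjmxE hX.
have r01 : X 0 1 = Num.conj (X 1 0) by rewrite -adjmxE hX.
apply: matrix2P; rewrite /bloch !mx2E !mxE /=.
- exact: esym r00.
- by rewrite r01 conjcE; case: (X 1 0).
- by case: (X 1 0).
by rewrite rmorphN /= -r00 tX opprK.
Qed.

Lemma bloch_span (X : 'M[C]_2) : X = (\tr X / 2) *: 1%:M
  + ((X 1 0 + X 0 1) / 2) *: bloch (delta_mx 0 0)
  + ((X 1 0 - X 0 1) / (2 * 'i%R)) *: bloch (delta_mx 0 1)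
  + ((X 0 0 - X 1 1) / 2) *: bloch (delta_mx 0 2).
Proof.
have ii : 'i%R * 'i%R = -1 :> C by rewrite -expr2 sqrCi.
have i0 : 'i%R != 0 :> C by apply: neq0Ci.
rewrite mx2_trace mx2_1 /bloch !mxE /= !complex_split ?oppr0 !rmorph0 !rmorph1 ?rmorphN.
rewrite !mx2Z !mx2D.
by apply: matrix2P; rewrite !mx2E; field: ii.
Qed.

Lemma bloch_sum (v : 'rV[R]_3) :
  bloch v = \sum_i (v 0 i)%:C *: bloch (delta_mx 0 i).
Proof.
rewrite {1}[v]row_sum_delta; elim/big_ind2: _ => [|x1 x2 y1 y2 e1 e2|i _].
- by apply: matrix2P; rewrite /bloch !mx2E !mxE ?oppr0.
- by rewrite blochD e1 e2.
by rewrite blochZ.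
Qed.

(** On traceless Hermitian matrices P is a real 3 by 3 matrix. Unitaries that rotate the z axis to
    its singular vectors turn the two singular equations into the hypotheses of
    [square_decomposable_pauliZ]. *)
Lemma square_decomposable_unital_tp P :
  (forall X, P (adjmx X) = adjmx (P X)) -> P 1%:M = 1%:M ->
  (forall X, \tr (P X) = \tr X) -> square_decomposable P.
Proof.
move=> hP P1 trP.
pose A : 'M[R]_3 := \matrix_i unbloch (P (bloch (delta_mx 0 i))).
have PA v : P (bloch v) = bloch (v *m A).
  rewrite bloch_sum linear_sum mulmx_sum_row.
  elim/big_ind2: _ => [|x1 x2 y1 y2 e1 e2|i _].
  - by apply: matrix2P; rewrite /bloch !mx2E !mxE ?oppr0.
  - by rewrite blochD e1 e2.
  rewrite blochZ linearZ rowK unblochK // ?trP ?tr_bloch //.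
  by rewrite -hP adj_bloch.
have [v [w [c [vv ww vA wA]]]] := singular_pair A isT.
(* The equation for A^T says that the trace adjoint of P sends [bloch w] to c times [bloch v]. *)
have adj X : \tr (bloch w *m P X) = c%:C * \tr (bloch v *m X).
  have e i : \tr (bloch w *m P (bloch (delta_mx 0 i))) =
             c%:C * \tr (bloch v *m bloch (delta_mx 0 i)).
    rewrite PA !tr_blochM -rmorphM; congr _%:C.
    have -> : dot w (delta_mx 0 i *m A) = dot (w *m A^T) (delta_mx 0 i).
      by rewrite dotM trmxK.
    by rewrite wA dotZl; ring.
  have [a1 [a2 [a3 [a4 ->]]]] : exists a1 a2 a3 a4, X = a1 *: 1%:M
      + a2 *: bloch (delta_mx 0 0) + a3 *: bloch (delta_mx 0 1)
      + a4 *: bloch (delta_mx 0 2) by do 4 eexists; exact: bloch_span.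
  rewrite !linearD !linearZ /= P1.
  by rewrite !mulmx1 !tr_bloch !e; ring.
have [U UU UV] := bloch_unitary vv; have [W WW WV] := bloch_unitary ww.
have unit_of (K : 'M[C]_2) : K *m adjmx K = 1%:M -> K \in unitmx.
  by move=> /mulmx1_unit [].
have WW' : adjmx W *m W = 1%:M by apply: mulmx1C.
apply: (@square_decomposable_conjg _ _ _ P U (adjmx W)); rewrite ?adjmx_unit ?unit_of //.
have conjK X : conjg_mx (adjmx W) (conjg_mx W X) = X.
  by rewrite /conjg_mx adjmxK !mulmxA WW' mul1mx -mulmxA WW' mulmx1.
have trU (K : 'M[C]_2) X : K *m adjmx K = 1%:M -> \tr (conjg_mx (adjmx K) X) = \tr X.
  by move=> KK; rewrite /conjg_mx adjmxK mxtrace_mulC mulmxA KK mul1mx.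
pose Q := [the {linear 'M[C]_2 -> 'M[C]_2} of conjg_mx (adjmx W) \o P \o conjg_mx U].
have adj_conjg (K : 'M[C]_2) X : adjmx (conjg_mx K X) = conjg_mx K (adjmx X).
  by rewrite /conjg_mx !adjmxM adjmxK mulmxA.
apply: (@square_decomposable_pauliZ Q c) => [X||||X] /=.
- by rewrite adj_conjg -hP adj_conjg.
- by rewrite conjg_mx1 // P1 conjg_mx1 // adjmxK.
- have -> : P (conjg_mx U (pauliZ)) = conjg_mx W (c%:C *: pauliZ).
    by rewrite UV PA vA blochZ -WV linearZ.
  by rewrite conjK.
- by move=> X; rewrite trU // trP -{1}[U]adjmxK trU // adjmxK; apply: mulmx1C.
have -> : \tr (pauliZ *m conjg_mx (adjmx W) (P (conjg_mx U X))) =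
          \tr (bloch w *m P (conjg_mx U X)).
  by rewrite -WV /conjg_mx adjmxK !mulmxA mxtrace_mulC !mulmxA.
rewrite adj -UV /conjg_mx !mulmxA; congr (_ * _).
have UU' : adjmx U *m U = 1%:M by apply: mulmx1C.
rewrite -[U *m pauliZ *m adjmx U *m U]mulmxA UU' mulmx1 mxtrace_mulC !mulmxA.
by rewrite UU' mul1mx.
Qed.

End UnitalTracePreserving.

(** * Maximum of a quotient on a compact set *)

Section ExtremeValue.
Local Open Scope classical_set_scope.
Variables (R : realType) (n : nat).
Implicit Types f g : 'rV[R]_n -> R.

Lemma continuous_coord i : continuous (fun v : 'rV[R]_n => v 0 i).
Proof. exact: coord_continuous. Qed.

Lemma continuous_sum (T : topologicalType) (I : Type) (r : seq I)
    (F : I -> T -> R) : (forall i, continuous (F i)) ->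
  continuous (fun v => \sum_(i <- r) F i v).
Proof.
move=> cF; elim: r => [|i r IHr] v.
  under eq_fun do rewrite big_nil; exact: cvg_cst.
under eq_fun do rewrite big_cons.
by apply: cvgD; [exact: cF | exact: IHr].
Qed.

Lemma continuous_linear_form (c : 'I_n -> R) :
  continuous (fun v : 'rV[R]_n => \sum_i v 0 i * c i).
Proof.
have h i : continuous (fun v : 'rV[R]_n => v 0 i * c i).
  by move=> v; apply: continuousM; [exact: continuous_coord | exact: cst_continuous].
exact: continuous_sum.
Qed.

(** The feasible set is closed as an intersection of preimages of half-lines. The index type is
    arbitrary because the closedness argument uses infinitely many constraints, there with
    denominator 1. *)
Lemma max_ratio_ex (I : Type) (F : I -> 'rV[R]_n -> R) (M : R) f g :
  (forall i, continuous (F i)) -> continuous f -> continuous g ->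
  (forall v, (forall i, 0 <= F i v) -> forall j, `|v 0 j| <= M) ->
  (forall v, (forall i, 0 <= F i v) -> 0 < g v) ->
  (exists v, forall i, 0 <= F i v) ->
  exists2 v, forall i, 0 <= F i v &
    forall w, (forall i, 0 <= F i w) -> f w / g w <= f v / g v.
Proof.
move=> cF cf cg bM g0 [v0 Kv0].
pose K := [set v : 'rV[R]_n | forall i, 0 <= F i v].
have [||| v] := @EVT_max_rV R n (fun v => f v / g v) K.
- by exists v0.
- apply: bounded_closed_compact.
    exists `|M|; split; first exact: num_real.
    move=> x Mx v Kv /=; rewrite /Num.norm /= mx_normrE.
    apply/bigmax_leP; split.
      exact: le_trans (normr_ge0 M) (ltW Mx).
    move=> [i j] _ /=; rewrite ord1; apply: le_trans (ltW Mx); apply: le_trans (ler_norm M).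
    exact: bM.
  have -> : K = \bigcap_(i in setT) (F i @^-1` [set x | 0 <= x]).
    by apply/seteqP; split=> v /= H i => [_|]; apply: H.
  apply: closed_bigI => i _; apply: closed_comp; last exact: closed_ge.
  by move=> v _; apply: cF.
- rewrite continuous_subspace_in => v /[!inE] Kv.
  apply: continuous_subspaceT_for.
    exact: Kv.
  apply: continuousM; first exact: cf.
  by apply: continuousV; [rewrite gt_eqF // g0 | exact: cg].
rewrite inE => Kv H; exists v => // w Kw; apply: H; rewrite inE; exact: Kw.
Qed.

End ExtremeValue.

(** * Positive semidefinite matrices of size 2 *)

Section Psd2.
Variable C : numClosedFieldType.

Lemma qform_mx2 (X : 'M[C]_2) x : qform X x =
  (x 0 0)^* * X 0 0 * x 0 0 + (x 0 0)^* * X 0 1 * x 1 0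
  + ((x 1 0)^* * X 1 0 * x 0 0 + (x 1 0)^* * X 1 1 * x 1 0).
Proof. by rewrite qformE !big_ord2. Qed.

(** The form at (- X01, X00) is X00 det X, and similarly with X11. If both diagonal entries vanish,
    the form at (X01, -1) is 2 det X. *)
Lemma psd_det2_ge0 (X : 'M[C]_2) : psd X -> 0 <= \det X.
Proof.
move=> pX; have hX := psd_adj pX.
have e10 : X 1 0 = (X 0 1)^* by rewrite -adjmxE hX.
have q (a b : C) : 0 <= a^* * X 0 0 * a + a^* * X 0 1 * b
    + (b^* * (X 0 1)^* * a + b^* * X 1 1 * b).
  have := psd_ge0 (\col_i (if i == 0 then a else b)) pX.
  by rewrite qform_mx2 !mxE /= e10.
have x0 := psd_diag_ge0 0 pX; have y0 := psd_diag_ge0 1 pX.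
have cx := geC0_conj x0; have cy := geC0_conj y0.
rewrite mx2_det e10.
have [x1|x1] := eqVneq (X 0 0) 0; last first.
  have xp : 0 < X 0 0 by rewrite lt0r x1.
  rewrite -(pmulr_rge0 _ xp); have := q (- X 0 1) (X 0 0).
  by rewrite rmorphN cx; congr (0 <= _); ring.
have [y1|y1] := eqVneq (X 1 1) 0; last first.
  have yp : 0 < X 1 1 by rewrite lt0r y1.
  rewrite -(pmulr_rge0 _ yp); have := q (X 1 1) (- (X 0 1)^*).
  by rewrite rmorphN /= conjCK cy; congr (0 <= _); ring.
rewrite -(pmulr_rge0 _ (ltr0n C 2)); have := q (X 0 1) (-1).
by rewrite rmorphN /= conjC1 x1 y1; congr (0 <= _); ring.
Qed.

Lemma psd_mx2P (X : 'M[C]_2) : adjmx X = X -> 0 <= X 0 0 -> 0 <= X 1 1 ->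
  0 <= \det X -> psd X.
Proof.
move=> hX x0 y0; have e10 : X 1 0 = (X 0 1)^* by rewrite -adjmxE hX.
have cx := geC0_conj x0.
rewrite mx2_det e10 => d0; apply/psdP => v; rewrite qform_mx2 e10.
have [x1|x1] := eqVneq (X 0 0) 0; last first.
  have xp : 0 < X 0 0 by rewrite lt0r x1.
  rewrite -(pmulr_rge0 _ xp).
  set a := v 0 0; set b := v 1 0.
  have -> : X 0 0 * (a^* * X 0 0 * a + a^* * X 0 1 * b
      + (b^* * (X 0 1)^* * a + b^* * X 1 1 * b)) =
    (X 0 0 * a + X 0 1 * b) * (X 0 0 * a + X 0 1 * b)^*
    + (X 0 0 * X 1 1 - X 0 1 * (X 0 1)^*) * (b * b^*).
    by rewrite rmorphD !rmorphM /= cx; ring.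
  by apply: addr_ge0; [|apply: mulr_ge0 => //]; exact: mul_conjC_ge0.
have z0 : X 0 1 = 0.
  move: d0; rewrite x1 mul0r sub0r oppr_ge0 => d0.
  by apply/eqP; rewrite -mul_conjC_eq0 eq_le d0 mul_conjC_ge0.
rewrite x1 z0 conjC0 !(mulr0, mul0r, add0r).
by rewrite mulrAC mulr_ge0 // mulrC mul_conjC_ge0.
Qed.

(** A Cholesky factor. If X00 = 0, the determinant can only be nonnegative when the off-diagonal
    entries vanish. *)
Lemma psd_factor2 (X : 'M[C]_2) : psd X -> exists A : 'M[C]_2, A *m adjmx A = X.
Proof.
move=> pX; have hX := psd_adj pX.
have e10 : X 0 1 = (X 1 0)^* by rewrite -adjmxE hX.
have x0 := psd_diag_ge0 0 pX; have y0 := psd_diag_ge0 1 pX.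
have d0 := psd_det2_ge0 pX.
have csqrt (z : C) : 0 <= z -> (sqrtC z)^* = sqrtC z.
  by move=> z0; apply: geC0_conj; rewrite sqrtC_ge0.
have [x1|x1] := eqVneq (X 0 0) 0.
  have z1 : X 1 0 = 0.
    move: d0; rewrite mx2_det x1 mul0r sub0r oppr_ge0 e10 mulrC => d0.
    by apply/eqP; rewrite -mul_conjC_eq0 eq_le d0 mul_conjC_ge0.
  exists (mx2 0 0 0 (sqrtC (X 1 1))).
  rewrite adjmx_mx2 mx2M csqrt // conjC0; apply: matrix2P; rewrite !mx2E;
    rewrite ?(mul0r, mulr0, addr0, add0r) ?e10 ?z1 ?x1 ?conjC0 //.
  by rewrite -expr2 sqrtCK.
pose s := sqrtC (X 0 0); pose t := sqrtC (\det X / X 0 0).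
have cs : s^* = s by apply: csqrt.
have ct : t^* = t by apply: csqrt; rewrite divr_ge0.
have sn : s != 0 by rewrite sqrtC_eq0.
have ss : s ^+ 2 = X 0 0 := sqrtCK _.
have tt : t ^+ 2 = \det X / X 0 0 := sqrtCK _.
exists (mx2 s 0 (X 1 0 / s) t).
rewrite adjmx_mx2 mx2M fmorph_div /= cs ct conjC0; apply: matrix2P; rewrite !mx2E.
- by rewrite mul0r addr0 -expr2.
- by rewrite mul0r addr0 mulrCA divff // mulr1 e10.
- by rewrite mulr0 addr0 divfK.
by rewrite -expr2 tt mx2_det -ss e10; field.
Qed.

Lemma psd_tens2 (X Y : 'M[C]_2) : psd X -> psd Y -> @psd C (2 * 2) (X *t Y).
Proof.
move=> /psd_factor2 [A <-] /psd_factor2 [B <-].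
rewrite -tensmx_mul -adjmx_tens -[X in X *m _]mulmx1.
exact/psd_congr/psd1.
Qed.

Lemma det_conjg n (K X : 'M[C]_n) :
  \det (conjg_mx K X) = \det K * (\det K)^* * \det X.
Proof.
rewrite /conjg_mx !det_mulmx /adjmx det_tr -det_map_mx mulrAC.
by [].
Qed.

End Psd2.

(** * The density matrix that maximizes the ratio of determinants *)

Section Scaling.
Local Open Scope complex_scope.
Variable R : realType.
Local Notation C := (R[i]).
Implicit Type P : {linear 'M[C]_2 -> 'M[C]_2}.

(** Real coordinates for Hermitian matrices, in which the extreme value theorem applies. *)
Definition hmx (v : 'rV[R]_4) : 'M[C]_2 :=
  mx2 (v 0 0)%:C (v 0 1 +i* v 0 2) (v 0 1 -i* v 0 2) (v 0 3)%:C.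

Definition hdet (v : 'rV[R]_4) : R := v 0 0 * v 0 3 - v 0 1 ^+ 2 - v 0 2 ^+ 2.

Definition unhmx (X : 'M[C]_2) : 'rV[R]_4 :=
  \row_j (if j == 0 then complex.Re (X 0 0)
    else if j == 1 then complex.Re (X 0 1)
    else if j == 2 then complex.Im (X 0 1) else complex.Re (X 1 1)).

Lemma adj_hmx v : adjmx (hmx v) = hmx v.
Proof.
by rewrite /hmx adjmx_mx2 !conjcE; apply: matrix2P; rewrite !mx2E; simpc.
Qed.

Lemma unhmxK X : adjmx X = X -> hmx (unhmx X) = X.
Proof.
move=> hX.
have rd k : (complex.Re (X k k))%:C = X k k.
  by apply/RRe_real/CrealP; rewrite -adjmxE hX.
have r10 : X 1 0 = Num.conj (X 0 1) by rewrite -adjmxE hX.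
apply: matrix2P; rewrite /hmx !mx2E !mxE /=.
- exact: rd.
- by case: (X 0 1).
- by rewrite r10 conjcE; case: (X 0 1).
exact: rd.
Qed.

Lemma hmxZ a v : hmx (a *: v) = a%:C *: hmx v.
Proof.
by rewrite /hmx mx2Z !mxE; apply: matrix2P; rewrite !mx2E; simpc.
Qed.

Lemma hmxD v w : hmx (v + w) = hmx v + hmx w.
Proof.
by rewrite /hmx mx2D !mxE; apply: matrix2P; rewrite !mx2E; simpc;
  rewrite -?opprD.
Qed.

Lemma hmx0 : hmx 0 = 0.
Proof. by apply: matrix2P; rewrite /hmx !mx2E !mxE ?oppr0. Qed.

Lemma det_hmx v : \det (hmx v) = (hdet v)%:C.
Proof.
rewrite mx2_det !mx2E /hdet !complex_split !(rmorphN, rmorphD, rmorphM, rmorphXn) /=.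
have ii : 'i%R * 'i%R = -1 :> C by rewrite -expr2 sqrCi.
by ring: ii.
Qed.

Lemma linear_hmx P : (forall X, P (adjmx X) = adjmx (P X)) ->
  exists B, forall v, P (hmx v) = hmx (v *m B).
Proof.
move=> hP; exists (\matrix_i unhmx (P (hmx (delta_mx 0 i)))) => v.
rewrite {1}[v]row_sum_delta mulmx_sum_row.
elim/big_ind2: _ => [|x1 x2 y1 y2 e1 e2|i _].
- by rewrite hmx0 linear0.
- by rewrite !hmxD linearD e1 e2.
rewrite !hmxZ linearZ rowK unhmxK //.
by rewrite -hP adj_hmx.
Qed.

Lemma continuous_hdet (g : 'rV[R]_4 -> 'rV[R]_4) :
  (forall j, continuous (fun v => g v 0 j)) -> continuous (fun v => hdet (g v)).
Proof.
move=> cg.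
have cM i j : continuous (fun v => g v 0 i * g v 0 j).
  by move=> v; apply: continuousM; apply: cg.
move=> v; rewrite /hdet.
under eq_fun do rewrite !expr2.
apply: (@continuousB _ _ _ (fun v => g v 0 0 * g v 0 3 - g v 0 1 * g v 0 1)).
  by apply: continuousB; exact: cM.
exact: cM.
Qed.

Lemma scaling_point P : (forall X, P (adjmx X) = adjmx (P X)) ->
  (forall X, psd X -> \tr X = 1 -> 0 < \det (P X)) ->
  exists X0, [/\ psd X0, 0 < \det X0, 0 < \det (P X0) &
    forall X, psd X -> \det X * \det (P X0) <= \det (P X) * \det X0].
Proof.
move=> hP dP; have [B PB] := linear_hmx hP.
(* Density matrices described by inequalities alone; the last two together fix the trace. *)
pose F (k : 'I_5) (v : 'rV[R]_4) := match val k with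
  | 0%N => v 0 0 | 1%N => v 0 3 | 2%N => hdet v
  | 3%N => v 0 0 + v 0 3 - 1 | _ => 1 - (v 0 0 + v 0 3) end.
have FP v : (forall k, 0 <= F k v) <-> psd (hmx v) /\ \tr (hmx v) = 1.
  rewrite mx2_trace !mx2E -rmorphD; split=> [Fv|[pv tv]].
    have f0 : 0 <= v 0 0 := Fv 0.
    have f1 : 0 <= v 0 3 := Fv 1.
    have f2 : 0 <= hdet v := Fv 2.
    have f3 : 0 <= v 0 0 + v 0 3 - 1 := Fv 3.
    have f4 : 0 <= 1 - (v 0 0 + v 0 3) := Fv 4.
    split; last by rewrite (_ : v 0 0 + v 0 3 = 1) //; lra.
    by apply: psd_mx2P; rewrite ?adj_hmx ?det_hmx ?mx2E ?ler0c.
  have t1 : v 0 0 + v 0 3 = 1 by apply: (@complexI R); rewrite tv.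
  have := psd_diag_ge0 0 pv; have := psd_diag_ge0 1 pv.
  have := psd_det2_ge0 pv; rewrite det_hmx !mx2E !ler0c => h0 h1 h2.
  by case=> [[|[|[|[|k]]]] hk]; rewrite /F /= ?t1 ?subrr.
have dB v : psd (hmx v) -> \tr (hmx v) = 1 -> 0 < hdet (v *m B).
  by move=> pv tv; have := dP _ pv tv; rewrite PB det_hmx ltcR.
have [||||||v Kv H] := @max_ratio_ex R 4 'I_5 F 1 hdet (fun v => hdet (v *m B)).
- have cc := @continuous_coord R 4.
  have cs : continuous (fun v : 'rV[R]_4 => v 0 0 + v 0 3).
    by move=> v; apply: continuousD; apply: cc.
  have c1 : continuous (fun v : 'rV[R]_4 => 1 : R) by move=> v; apply: cst_continuous.
  case=> [[|[|[|[|k]]]] hk]; rewrite /F /=.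
  + exact: cc.
  + exact: cc.
  + exact: (continuous_hdet (g := id)).
  + move=> v; apply: (@continuousB _ _ _ (fun v : 'rV[R]_4 => v 0 0 + v 0 3)).
      exact: cs.
    exact: c1.
  + move=> v; apply: (@continuousB _ _ _ (fun v : 'rV[R]_4 => 1 : R)).
      exact: c1.
    exact: cs.
- by apply: (continuous_hdet (g := id)); apply: continuous_coord.
- apply: continuous_hdet => j.
  have -> : (fun v : 'rV[R]_4 => (v *m B) 0 j) = (fun v => \sum_i v 0 i * B i j).
    by apply/funext => v; rewrite mxE.
  exact: continuous_linear_form.
- move=> v Fv.
  have f0 : 0 <= v 0 0 := Fv 0.
  have f1 : 0 <= v 0 3 := Fv 1.
  have f2 : 0 <= hdet v := Fv 2.
  have f4 : 0 <= 1 - (v 0 0 + v 0 3) := Fv 4.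
  rewrite /hdet in f2.
  have p : v 0 0 * v 0 3 <= 1 by nra.
  have q1 := sqr_ge0 (v 0 1); have q2 := sqr_ge0 (v 0 2).
  case=> [[|[|[|[|//]]]] hj]; rewrite ler_norml.
  + rewrite (_ : Ordinal hj = 0); last exact: val_inj.
    by apply/andP; split; lra.
  + rewrite (_ : Ordinal hj = 1); last exact: val_inj.
    by apply/andP; split; nra.
  + rewrite (_ : Ordinal hj = 2); last exact: val_inj.
    by apply/andP; split; nra.
  + rewrite (_ : Ordinal hj = 3); last exact: val_inj.
    by apply/andP; split; lra.
- by move=> v /FP [pv tv]; apply: dB.
- exists (\row_j (if (j == 0) || (j == 3) then 2^-1 else 0)).
  by case=> [[|[|[|[|k]]]] hk]; rewrite /F /hdet !mxE /=; lra.
have [pv tv] := (FP v).1 Kv.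
have gv := dB v pv tv.
have main w : psd (hmx w) -> \tr (hmx w) = 1 ->
    hdet w * hdet (v *m B) <= hdet (w *m B) * hdet v.
  move=> pw tw; have /FP Kw := conj pw tw.
  have := H w Kw; rewrite ler_pdivrMr ?dB // mulrAC ler_pdivlMr //.
  by rewrite [hdet v * _]mulrC.
exists (hmx v); rewrite det_hmx ltcR; split=> //; last 1 first.
(* Both sides are homogeneous of degree 2, so the bound at trace 1 extends to all positive
   semidefinite X; trace 0 means X = 0. *)
- move=> X pX; have t0 := psd_trace_ge0 pX.
  have [tX|tX] := eqVneq (\tr X) 0.
    suff -> : X = 0 by rewrite linear0 det0 !mul0r.
    have x0 := psd_diag_ge0 0 pX; have x1 := psd_diag_ge0 1 pX.
    move/eqP: tX; rewrite mx2_trace paddr_eq0 // => /andP [/eqP e0 /eqP e1].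
    have e10 : X 1 0 = Num.conj (X 0 1) by rewrite -adjmxE (psd_adj pX).
    have := psd_det2_ge0 pX; rewrite mx2_det e0 mul0r sub0r oppr_ge0 e10 => d0.
    have /eqP : X 0 1 * Num.conj (X 0 1) = 0.
      by apply/eqP; rewrite eq_le d0 mul_conjC_ge0.
    rewrite mul_conjC_eq0 => /eqP e01.
    by apply: matrix2P; rewrite !mxE // e10 e01 conjC0.
  have tp : 0 < \tr X by rewrite lt0r tX.
  pose Y := (\tr X)^-1 *: X.
  have pY : psd Y by apply: psdZ => //; rewrite invr_ge0.
  have tY : \tr Y = 1 by rewrite mxtraceZ mulVf.
  have XY : X = \tr X *: Y by rewrite scalerA divff // scale1r.
  have YE := unhmxK (psd_adj pY).
  have mY : \det Y * (hdet (v *m B))%:C <= \det (P Y) * (hdet v)%:C.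
    by rewrite -YE PB !det_hmx -!rmorphM lecR; apply: main; rewrite YE.
  have -> : \det X = (\tr X) ^+ 2 * \det Y by rewrite {1}XY detZ.
  have -> : \det (P X) = (\tr X) ^+ 2 * \det (P Y) by rewrite {1}XY linearZ detZ.
  have : 0 <= (\tr X) ^+ 2 by apply: exprn_ge0.
  rewrite PB det_hmx; move: (_ ^+ 2) => t t2.
  by rewrite -!mulrA; apply: ler_wpM2l.
(* Comparison with half the identity shows that the maximal ratio, hence det X0, is positive. *)
- pose w : 'rV[R]_4 := \row_j (if (j == 0) || (j == 3) then 2^-1 else 0).
  have /FP [pw tw] : forall k, 0 <= F k w.
    by case=> [[|[|[|[|k]]]] hk]; rewrite /F /hdet !mxE /=; lra.
  have := main w pw tw; rewrite -(pmulr_rgt0 _ (dB w pw tw)).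
  apply: lt_le_trans; apply: mulr_gt0 => //.
  by rewrite /hdet !mxE /=; lra.
exact: dP.
Qed.

End Scaling.

(** * Stationarity and the normalization of P *)

Lemma first_order_eq0 (R : realFieldType) (k n : R) :
  (forall t, -1 <= t <= 1 -> 0 <= t * k + t ^+ 2 * n) -> k = 0.
Proof.
move=> H; pose N := 1 + `|k| + `|n|.
have nk := normr_ge0 k; have nn := normr_ge0 n.
have N0 : 0 < N by rewrite /N; lra.
(* A step against the sign of k, with N large enough for |t| <= 1 and n < N; multiplied by N^2, the
   hypothesis reads k^2 (n - N) >= 0. *)
have := H (- k / N); rewrite -ler_norml normrM normrN normfV (gtr0_norm N0).
rewrite ler_pdivrMr // mul1r => /(_ _)/wrap[|h]; first by rewrite /N; lra.
have n1 : n <= `|n| := ler_norm n.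
have h2 : 0 <= k ^+ 2 * (n - N).
  have : 0 <= N ^+ 2 * (- k / N * k + (- k / N) ^+ 2 * n).
    by apply: mulr_ge0 => //; apply: sqr_ge0.
  by congr (0 <= _); field; rewrite gt_eqF.
have k2 := sqr_ge0 k.
have : k ^+ 2 <= 0 by rewrite /N in h2; nra.
move=> k0; apply/eqP; rewrite -sqrf_eq0 eq_le k0 //.
Qed.

Section Normalization.
Local Open Scope complex_scope.
Variable R : realType.
Local Notation C := (R[i]).
Implicit Type P : {linear 'M[C]_2 -> 'M[C]_2}.

Lemma det_bloch (v : 'rV[R]_3) : \det (bloch v) = - (dot v v)%:C.
Proof.
rewrite mx2_det !mx2E dotE big_ord3 !complex_split !(rmorphN, rmorphD, rmorphM) /=.
have ii : 'i%R * 'i%R = -1 :> C by rewrite -expr2 sqrCi.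
by ring: ii.
Qed.

Lemma det_1D (a : C) (K : 'M[C]_2) :
  \det (1%:M + a *: K) = 1 + a * \tr K + a ^+ 2 * \det K.
Proof. by rewrite !mx2_det mx2_trace !mxE /=; ring. Qed.

(* First-order condition at X = 1. *)
Lemma trace_preserving_of_det P :
  (forall X, P (adjmx X) = adjmx (P X)) -> P 1%:M = 1%:M ->
  (forall X, psd X -> \det X <= \det (P X)) -> forall X, \tr (P X) = \tr X.
Proof.
move=> hP P1 dP.
have key v : dot v v = 1 -> \tr (P (@bloch R v)) = 0.
  move=> vv; set K := P _.
  have hK : adjmx K = K by rewrite -hP adj_bloch.
  have rtr : \tr K \is Num.real.
    by apply/CrealP; rewrite mx2_trace rmorphD /= -!adjmxE hK.
  have rdet : \det K \is Num.real.
    apply/CrealP; rewrite mx2_det rmorphB !rmorphM /= -!adjmxE hK.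
    by ring.
  have [k ek] := complex_realP _ rtr; have [m em] := complex_realP _ rdet.
  (* The quadratic coefficient is det K + 1, because det (1 + t bloch v) = 1 - t^2. *)
  rewrite ek (@first_order_eq0 R k (m + 1)) // => t /andP [t1 t2].
  have e : 0 <= \det (1%:M + t%:C *: K) - \det (1%:M + t%:C *: bloch v).
    rewrite subr_ge0 -{2}P1 -linearZ -linearD; apply: dP.
    have dt : \det (1%:M + t%:C *: bloch v) = (1 - t ^+ 2)%:C.
      rewrite det_1D tr_bloch det_bloch vv mulr0 addr0 rmorph1 mulrN1.
      by rewrite rmorphB rmorph1 rmorphXn.
    rewrite dotE big_ord3 in vv.
    have h1 := sqr_ge0 (v 0 0); have h2 := sqr_ge0 (v 0 1).
    apply: psd_mx2P.
    - by rewrite adjmxD adjmxZ adjmx1 adj_bloch conjcE conjc_real.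
    - rewrite !mxE /= mulr1n -rmorphM -(rmorph1 (real_complex R)) -rmorphD ler0c.
      by nra.
    - rewrite !mxE /= mulr1n -rmorphM -(rmorph1 (real_complex R)) -rmorphD ler0c.
      by nra.
    by rewrite dt ler0c; nra.
  move: e.
  rewrite !det_1D ek em tr_bloch det_bloch vv -ler0c; congr (0 <= _).
  by rewrite !(rmorphD, rmorphM, rmorphXn, rmorph1) /=; ring.
have d1 (i : 'I_3) : dot (delta_mx 0 i) (delta_mx 0 i) = 1 :> R.
  rewrite dotE (bigD1 i) //= big1 ?addr0 ?mxE ?eqxx ?mulr1 // => j /negPf nj.
  by rewrite mxE nj andbF mul0r.
move=> X; rewrite [X]bloch_span !linearD !linearZ /= P1 !key // !tr_bloch.
by rewrite !mulr0 !addr0.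
Qed.

(** Factor X0 through A and P(X0) through B. Conjugating P by A before and by the inverse of B after
    gives a map Q with Q(1) = 1, and maximality of the ratio at X0 becomes det X <= det Q(X). *)
Lemma square_decomposable_strict P :
  (forall X, P (adjmx X) = adjmx (P X)) ->
  (forall X, psd X -> psd (P X)) ->
  (forall X, psd X -> \tr X = 1 -> 0 < \det (P X)) -> square_decomposable P.
Proof.
move=> hP pP dP.
have [X0 [pX0 dX0 dPX0 H]] := scaling_point hP dP.
have unit_factor (K X : 'M[C]_2) : K *m adjmx K = X -> 0 < \det X -> K \in unitmx.
  move=> <- d; have : K *m adjmx K \in unitmx by rewrite unitmxE unitfE gt_eqF.
  by rewrite unitmx_mul => /andP [].
have [A AX] := psd_factor2 pX0; have uA := unit_factor _ _ AX dX0.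
have [B BX] := psd_factor2 (pP _ pX0); have uB := unit_factor _ _ BX dPX0.
have uB' : invmx B \in unitmx by rewrite unitmx_inv.
apply: (@square_decomposable_conjg _ _ _ P A (invmx B)) => //.
pose Q := [the {linear 'M[C]_2 -> 'M[C]_2} of conjg_mx (invmx B) \o P \o conjg_mx A].
have adj_conjg (K X : 'M[C]_2) : adjmx (conjg_mx K X) = conjg_mx K (adjmx X).
  by rewrite /conjg_mx !adjmxM adjmxK mulmxA.
have c1 (K : 'M[C]_2) : conjg_mx K 1%:M = K *m adjmx K.
  by rewrite /conjg_mx mulmx1.
have hQ X : Q (adjmx X) = adjmx (Q X).
  by rewrite /Q /= adj_conjg -hP adj_conjg.
have Q1 : Q 1%:M = 1%:M.
  by rewrite /Q /= c1 AX -BX -c1 conjg_mx_inv.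
apply: (@square_decomposable_unital_tp R Q hQ Q1).
apply: trace_preserving_of_det => // X pX.
rewrite /Q /= det_conjg det_inv.
have := H _ (positive_conjg A pX); rewrite det_conjg -BX -[in \det X0]AX.
rewrite !det_mulmx /adjmx !det_tr !det_map_mx /=.
have a0 : 0 < \det A * Num.conj (\det A).
  by rewrite mul_conjC_gt0 -unitfE -unitmxE.
have b0 : 0 < \det B * Num.conj (\det B).
  by rewrite mul_conjC_gt0 -unitfE -unitmxE.
rewrite fmorphV -invfM [_^-1 * _]mulrC ler_pdivlMr //.
rewrite -mulrA [_ * (_ * Num.conj (\det A))]mulrC.
by rewrite ler_pM2l.
Qed.

End Normalization.

(** * The sign of P and the depolarizing perturbation *)

Section Perturbation.
Variable C : numClosedFieldType.
Implicit Type P : {linear 'M[C]_2 -> 'M[C]_2}.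

Lemma qform_tens m n (A : 'M[C]_m) (B : 'M[C]_n) (x : 'cV[C]_m) (y : 'cV[C]_n) :
  @qform C (m * n) (A *t B) (x *t y) = qform A x * qform B y.
Proof.
rewrite /qform -tensmxE -!tensmx_mul -adjmx_tens.
by congr (fun_of_matrix _ _ _); apply: val_inj.
Qed.

(** On product vectors and product matrices the form of P (x) P is a product of two forms of P, so
    one nonzero value z fixes the sign of all the others. *)
Lemma positive_or_opp P : positive_map (tensmap P P) ->
  positive_map P \/ positive_map (fun X => - P X).
Proof.
move=> pPP.
have [H|] := pselect (forall Y, psd Y -> P Y = 0).
  by left=> X pX; rewrite H //; exact: psd0.
move=> /existsNP [Y /not_implyP [pY PY]].
have [y zy] : exists y, qform (P Y) y != 0.
  apply/not_existsP => H; apply: PY; apply: qform_eq0 => x.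
  by have /negP := H x; rewrite negbK => /eqP.
have key X x : psd X -> 0 <= qform (P X) x * qform (P Y) y.
  move=> pX; have := psd_ge0 (x *t y) (pPP _ (psd_tens2 pX pY)).
  by rewrite tensmap_tens qform_tens.
set z := qform (P Y) y in zy key.
have z2 : 0 <= z ^+ 2 by rewrite expr2; apply: key.
(* P is not yet known to preserve Hermitian matrices; z is real because z^2 >= 0 makes it plus or
   minus a real square root. *)
have rz : z \is Num.real.
  have : z ^+ 2 == (sqrtC (z ^+ 2)) ^+ 2 by rewrite sqrtCK.
  have r : sqrtC (z ^+ 2) \is Num.real by rewrite ger0_real // sqrtC_ge0.
  by rewrite eqf_sqr => /orP [] /eqP ->; rewrite ?rpredN.
have [z0|z0|z0] := real_ltgtP rz (real0 C); last by rewrite z0 eqxx in zy.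
- right=> X pX; apply/psdP => x; rewrite -scaleN1r qformZ mulN1r oppr_ge0.
  by have := key X x pX; rewrite nmulr_lge0.
- left=> X pX; apply/psdP => x.
  by have := key X x pX; rewrite pmulr_lge0.
Qed.

Lemma tensmx11r (A : 'M[C]_2) (B : 'M[C]_1) : A *t B = B 0 0 *: A :> 'M_2.
Proof.
have e (i : 'I_2) : (mxtens_unindex (i : 'I_(2 * 1))) = (i, 0).
  by congr (_, _); [apply: val_inj; rewrite /= divn1 | rewrite ord1].
by apply/matrixP => i j; rewrite !mxE !e /= mulrC.
Qed.

Lemma tensmx11l (A : 'M[C]_2) (B : 'M[C]_1) : B *t A = B 0 0 *: A :> 'M_2.
Proof.
have e (i : 'I_2) : (mxtens_unindex (i : 'I_(1 * 2))) = (0, i).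
  congr (_, _); first by rewrite ord1.
  by apply: val_inj; rewrite /= modn_small.
by apply/matrixP => i j; rewrite !mxE !e /=.
Qed.

Definition trmap (X : 'M[C]_2) : 'M[C]_1 := (\tr X)%:M.
Definition unitmap (X : 'M[C]_1) : 'M[C]_2 := (X 0 0)%:M.

Lemma kraus_trmap : kraus (fun _ : 'I_2 => 1) (fun k => delta_mx 0 k) =1 trmap.
Proof.
move=> X; rewrite /kraus big_ord2 !scale1r /conjg_mx !adjmx_delta.
rewrite -!rowE -!colE /trmap mx2_trace; apply/matrixP => i j.
by rewrite !ord1 !mxE mulr1n.
Qed.

Lemma kraus_unitmap : kraus (fun _ : 'I_2 => 1) (fun k => delta_mx k 0) =1 unitmap.
Proof.
move=> X; rewrite /kraus big_ord2 !scale1r /conjg_mx !adjmx_delta /unitmap.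
rewrite [X]mx11_scalar !mul_mx_scalar -!scalemxAl !mul_delta_mx.
by apply: matrix2P; rewrite !mxE /= ?(mulr1, mulr0, addr0, add0r, mulr1n, mulr0n).
Qed.

Lemma positive_tensmap_kraus (I J : finType) m n p q a (K : I -> 'M[C]_(m, n))
    b (L : J -> 'M[C]_(p, q)) :
  (forall i, 0 <= a i) -> (forall j, 0 <= b j) ->
  positive_map (tensmap (kraus a K) (kraus b L)).
Proof.
move=> a0 b0 X pX; rewrite tensmap_kraus.
apply: psd_sum => i _; apply: psd_sum => j _.
by apply: psdZ; [apply: mulr_ge0 | apply: psd_congr].
Qed.

(** The identity in Kraus form, so that [positive_tensmap_kraus] applies to tensor products with
    it. *)
Definition idkraus n : 'M[C]_n -> 'M[C]_n :=
  kraus (fun _ : 'I_1 => 1) (fun _ => 1%:M).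

Lemma idkrausE n : @idkraus n =1 id.
Proof.
move=> X; rewrite /idkraus /kraus big_ord1 scale1r /conjg_mx adjmx1.
by rewrite mul1mx mulmx1.
Qed.

Definition trace_id (X : 'M[C]_2) : 'M[C]_2 := (\tr X)%:M.

(* P (x) tr(.) 1 factors through P (x) id_1, which is P itself since 2 * 1
   reduces to 2. *)
Lemma positive_tensmap_trace_r P :
  positive_map P -> positive_map (tensmap P trace_id).
Proof.
move=> pP.
pose Tr := kraus (fun _ : 'I_2 => 1 : C) (fun k => delta_mx 0 k : 'M[C]_(1, 2)).
pose Un := kraus (fun _ : 'I_2 => 1 : C) (fun k => delta_mx k 0 : 'M[C]_(2, 1)).
pose id1 := [the {linear 'M[C]_1 -> 'M[C]_1} of idfun].
have e1 : tensmap P id1 =1 (P : 'M[C]_(2 * 1) -> 'M[C]_(2 * 1)).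
  apply: (@linear_tens_ext C 2 1 (2 * 1)
            [the {linear _ -> _} of tensmap P id1] P) => A B.
  by rewrite /= tensmap_tens /= !tensmx11r linearZ.
have e X : tensmap P trace_id X =
    tensmap (@idkraus 2) Un (tensmap P id1 (tensmap (@idkraus 2) Tr X)).
  rewrite (tensmap_comp P id1) /Un /Tr /idkraus tensmap_comp.
  apply: eq_tensmap => Y /=; first by rewrite -!/(idkraus _) !idkrausE.
  by rewrite kraus_unitmap kraus_trmap /unitmap /trmap mxE mulr1n.
apply: (eq_positive (fsym e)).
have one0 : forall i : 'I_2, 0 <= (1 : C) by move=> _; exact: ler01.
apply: positive_comp; first by apply: positive_tensmap_kraus.
apply: positive_comp; first exact: (eq_positive (fsym e1)).
by apply: positive_tensmap_kraus.
Qed.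

Lemma positive_tensmap_trace_l P :
  positive_map P -> positive_map (tensmap trace_id P).
Proof.
move=> pP.
pose Tr := kraus (fun _ : 'I_2 => 1 : C) (fun k => delta_mx 0 k : 'M[C]_(1, 2)).
pose Un := kraus (fun _ : 'I_2 => 1 : C) (fun k => delta_mx k 0 : 'M[C]_(2, 1)).
pose id1 := [the {linear 'M[C]_1 -> 'M[C]_1} of idfun].
have e1 : tensmap id1 P =1 (P : 'M[C]_(1 * 2) -> 'M[C]_(1 * 2)).
  apply: (@linear_tens_ext C 1 2 (1 * 2)
            [the {linear _ -> _} of tensmap id1 P] P) => A B.
  by rewrite /= tensmap_tens /= !tensmx11l linearZ.
have e X : tensmap trace_id P X =
    tensmap Un (@idkraus 2) (tensmap id1 P (tensmap Tr (@idkraus 2) X)).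
  rewrite (tensmap_comp id1 P) /Un /Tr /idkraus tensmap_comp.
  apply: eq_tensmap => Y /=; last by rewrite -!/(idkraus _) !idkrausE.
  by rewrite kraus_unitmap kraus_trmap /unitmap /trmap mxE mulr1n.
apply: (eq_positive (fsym e)).
have one0 : forall i : 'I_2, 0 <= (1 : C) by move=> _; exact: ler01.
apply: positive_comp; first by apply: positive_tensmap_kraus.
apply: positive_comp; first exact: (eq_positive (fsym e1)).
by apply: positive_tensmap_kraus.
Qed.

Lemma trace_id_is_linear : linear trace_id.
Proof. by move=> a X Y; rewrite /trace_id linearP raddfD /= scale_scalar_mx. Qed.
HB.instance Definition _ :=
  GRing.isLinear.Build C 'M[C]_2 'M[C]_2 _ trace_id trace_id_is_linear.

Lemma positive_trace_id : positive_map trace_id.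
Proof.
move=> X pX; rewrite /trace_id -scalemx1; apply: psdZ; last exact: psd1.
exact: psd_trace_ge0.
Qed.

Definition depolarize (e : C) P (X : 'M[C]_2) : 'M[C]_2 := P X + e *: trace_id X.

Lemma depolarize_is_linear e P : linear (depolarize e P).
Proof.
move=> a X Y; rewrite /depolarize !linearP /= !scalerDr !scalerA [a * e]mulrC.
by rewrite -!addrA; congr (_ + _); rewrite addrCA.
Qed.
HB.instance Definition _ e P :=
  GRing.isLinear.Build C 'M[C]_2 'M[C]_2 _ (depolarize e P)
    (depolarize_is_linear e P).

Lemma tensmap_depolarize e P X :
  tensmap (depolarize e P) (depolarize e P) X = tensmap P P X +
   e *: (tensmap P trace_id X + tensmap trace_id P X
         + e *: tensmap trace_id trace_id X).
Proof.
rewrite /depolarize tensmapDl !tensmapDr !tensmapZl !tensmapZr.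
by rewrite !scalerDr !addrA.
Qed.

Lemma positive_tensmap_depolarize e P : 0 <= e -> positive_map P ->
  positive_map (tensmap P P) ->
  positive_map (tensmap (depolarize e P) (depolarize e P)).
Proof.
move=> e0 pP pPP X pX; rewrite tensmap_depolarize.
apply: psdD; first exact: pPP.
apply: psdZ => //; apply: psdD; first apply: psdD.
- exact: positive_tensmap_trace_r.
- exact: positive_tensmap_trace_l.
apply: psdZ => //.
exact: (@positive_tensmap_trace_r [the {linear _ -> _} of trace_id] positive_trace_id).
Qed.

Lemma det_depolarize_gt0 e P X : 0 < e -> positive_map P -> psd X ->
  \tr X = 1 -> 0 < \det (depolarize e P X).
Proof.
move=> e0 pP pX tX; rewrite /depolarize /trace_id tX scalemx1.
have -> : \det (P X + e%:M) = \det (P X) + (e * \tr (P X) + e ^+ 2).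
  by rewrite !mx2_det mx2_trace !mxE /= ?mulr1n ?mulr0n; ring.
apply: ltr_wpDl; first by apply: psd_det2_ge0; apply: pP.
apply: ltr_wpDl; last exact: exprn_gt0.
by apply: mulr_ge0; [exact: ltW | apply: psd_trace_ge0; apply: pP].
Qed.

End Perturbation.

Section PerturbedSquare.
Variable R : realType.
Local Notation C := (R[i]).
Implicit Type P : {linear 'M[C]_2 -> 'M[C]_2}.

(** Each Bloch basis matrix b is the difference of the positive semidefinite matrices 1 + b and 1,
    so its image is Hermitian. *)
Lemma positive_map_adj P : positive_map P -> forall X, P (adjmx X) = adjmx (P X).
Proof.
move=> pP.
have h1 : adjmx (P 1%:M) = P 1%:M by apply/psd_adj/pP/psd1.
have hb (i : 'I_3) : adjmx (P (bloch (delta_mx 0 i))) = P (@bloch R (delta_mx 0 i)).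
  set b := @bloch R _.
  have -> : b = (1%:M + b) - 1%:M by rewrite addrAC subrr add0r.
  have pb : psd (1%:M + b).
    have d1 : dot (delta_mx 0 i) (delta_mx 0 i) = 1 :> R.
      rewrite dotE (bigD1 i) //= big1 ?addr0 ?mxE ?eqxx ?mulr1 // => j /negPf nj.
      by rewrite mxE nj andbF mul0r.
    apply: psd_mx2P.
    - by rewrite adjmxD adjmx1 adj_bloch.
    - rewrite !mxE /= mulr1n; case: (_ == i); rewrite ?rmorph1 ?rmorph0 ?addr0.
        exact: addr_ge0 ler01 ler01.
      exact: ler01.
    - rewrite !mxE /= mulr1n; case: (_ == i); rewrite ?rmorphN ?rmorph1 ?rmorph0.
        by rewrite subrr.
      by rewrite oppr0 addr0 ler01.
    have := det_1D 1 b; rewrite scale1r => ->.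
    by rewrite tr_bloch det_bloch d1 mulr0 addr0 expr1n mul1r rmorph1 subrr.
  rewrite linearB /= -[in LHS]scaleN1r adjmxD adjmxZ h1 (psd_adj (pP _ pb)).
  by rewrite rmorphN /= conjC1 scaleN1r.
move=> X; rewrite [X]bloch_span !(adjmxD, adjmxZ, linearD, linearZ) /=.
by rewrite adjmx1 !adj_bloch h1 !hb.
Qed.

Lemma square_decomposable_depolarize (e : C) P : 0 < e -> positive_map P ->
  square_decomposable (depolarize e P).
Proof.
move=> e0 pP.
have pD : positive_map (depolarize e P).
  move=> X pX; apply: psdD; first exact: pP.
  by apply: psdZ; [exact: ltW | exact: positive_trace_id].
pose D := [the {linear 'M[C]_2 -> 'M[C]_2} of depolarize e P].
apply: (@square_decomposable_strict R D (@positive_map_adj D pD) pD) => X pX tX.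
exact: (det_depolarize_gt0 e0 pP pX tX).
Qed.

End PerturbedSquare.

(** * Entry bounds for completely positive maps *)

Section EntryBounds.
Variable C : numClosedFieldType.

(** The test vector is e_i - conj(g) e_j with g the phase of the entry, which turns both cross terms
    into - |A_ij|. *)
Lemma psd_entry_le n (A : 'M[C]_n) i j : psd A -> `|A i j| <= A i i + A j j.
Proof.
move=> pA; have hA := psd_adj pA.
have [g gg gE] := phase_ex (A i j).
have := psd_pair i j (- g^* ) pA; rewrite rmorphN /= conjCK.
have eji : A j i = (A i j)^* by rewrite -adjmxE hA.
rewrite eji gE rmorphM /= (geC0_conj (normr_ge0 _)).
have -> : A i i + - g^* * (`|A i j| * g) + - g * (`|A i j| * g^* ) + - g^* * - g * A j j
  = A i i - `|A i j| * (g * g^* ) *+ 2 + (g * g^* ) * A j j by ring.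
rewrite gg mulr1 mul1r => h.
have h2 : `|A i j| *+ 2 <= A i i + A j j by rewrite -subr_ge0 addrAC.
rewrite normrM normr_id [`|g|](_ : _ = 1) ?mulr1.
  by apply: le_trans h2; rewrite mulr2n lerDl.
by apply/eqP; rewrite -sqrp_eq1 // normCK gg.
Qed.

(** The values of T on matrix units are the entries of its Choi matrix, which is positive
    semidefinite. *)
Lemma cp_entry_le n m (T : {linear 'M[C]_n -> 'M[C]_m}) i j k l :
  completely_positive T ->
  `|T (delta_mx i j) k l| <= T (delta_mx i i) k k + T (delta_mx j j) l l.
Proof.
move=> cT; have pJ := cT n _ (psd_choi_id C n).
have tE A B : tensmap (fun X : 'M[C]_n => X) T (A *t B) = A *t T B.
  exact: (tensmap_tens [the {linear 'M[C]_n -> 'M[C]_n} of idfun] T).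
have E i' j' k' l' : tensmap (fun X : 'M[C]_n => X) T (choi_id C n)
    (mxtens_index (i', k')) (mxtens_index (j', l')) = T (delta_mx i' j') k' l'.
  rewrite /choi_id linear_sum summxE (bigD1 i') //= [X in _ + X]big1 ?addr0.
    rewrite linear_sum summxE (bigD1 j') //= [X in _ + X]big1 ?addr0.
      rewrite /= tE tensmxE.
      by rewrite mxE !eqxx mul1r.
    move=> j2 /negPf nj.
    rewrite /= tE tensmxE.
    by rewrite mxE eq_sym nj andbF mul0r.
  move=> i2 /negPf ni; rewrite linear_sum summxE big1 // => j2 _.
  rewrite /= tE tensmxE.
  by rewrite mxE eq_sym ni mul0r.
have := psd_entry_le (mxtens_index (i, k)) (mxtens_index (j, l)) pJ.
by rewrite !E.
Qed.

End EntryBounds.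

(** * Decomposability is a closed condition *)

Section Closedness.
Local Open Scope complex_scope.
Variables (R : realType) (d1 d2 : nat).
Local Notation C := (R[i]).
Local Notation E := ('I_d1 * 'I_d1 * 'I_d2 * 'I_d2)%type.
Local Notation N := #|{: bool * bool * E}|.

Definition entry_map (x : E) (X : 'M[C]_d1) : 'M[C]_d2 :=
  X x.1.1.1 x.1.1.2 *: delta_mx x.1.2 x.2.

(* A row vector encodes a pair of maps: the first boolean of an index selects
   the map, the second one the real or the imaginary part of the entry. *)
Definition entry (b : bool) (v : 'rV[R]_N) (x : E) : C :=
  v 0 (enum_rank (b, false, x)) +i* v 0 (enum_rank (b, true, x)).

Definition map_of_entries b v (X : 'M[C]_d1) : 'M[C]_d2 :=
  \sum_x entry b v x *: entry_map x X.

Lemma map_of_entries_is_linear b v : linear (map_of_entries b v).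
Proof.
move=> a X Y; rewrite /map_of_entries scaler_sumr -big_split; apply: eq_bigr => x _ /=.
by rewrite /entry_map !mxE !scalerA -scalerDl; congr (_ *: _); ring.
Qed.
HB.instance Definition _ b v :=
  GRing.isLinear.Build C 'M[C]_d1 'M[C]_d2 _ (map_of_entries b v)
    (map_of_entries_is_linear b v).

Lemma map_of_entries_delta b v i j k l :
  map_of_entries b v (delta_mx i j) k l = entry b v (i, j, k, l).
Proof.
rewrite /map_of_entries summxE (bigD1 (i, j, k, l)) //= big1 ?addr0.
  by rewrite /entry_map !mxE /= !eqxx !mulr1.
move=> [[[i' j'] k'] l'] ne; rewrite /entry_map !mxE /=.
apply/eqP; rewrite !mulf_eq0 !pnatr_eq0 !eqb0 -negb_and; apply/orP; right.
apply: contra ne => /andP [/andP [/eqP -> /eqP ->] /andP [/eqP -> /eqP ->]].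
by [].
Qed.

Lemma map_of_entries_ex (T S : {linear 'M[C]_d1 -> 'M[C]_d2}) : exists v,
  [/\ map_of_entries false v =1 T, map_of_entries true v =1 S &
     forall x, v 0 x = let: (b, c, (i, j, k, l)) := enum_val x in
       let z := (if b then S else T) (delta_mx i j) k l in
       if c then complex.Im z else complex.Re z].
Proof.
pose val (y : bool * bool * E) := let: (b, c, (i, j, k, l)) := y in
       let z := (if b then S else T) (delta_mx i j) k l in
       if c then complex.Im z else complex.Re z.
pose v : 'rV[R]_N := \row_x val (enum_val x).
have cE b i j k l : entry b v (i, j, k, l) = (if b then S else T) (delta_mx i j) k l.
  by rewrite /entry !mxE !enum_rankK /=; case: (_ k l).
exists v; split.
- apply: (linear_delta_ext (F := [the {linear _ -> _} of map_of_entries false v])) => i j.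
  by apply/matrixP => k l; rewrite /= map_of_entries_delta cE.
- apply: (linear_delta_ext (F := [the {linear _ -> _} of map_of_entries true v])) => i j.
  by apply/matrixP => k l; rewrite /= map_of_entries_delta cE.
by move=> x; rewrite mxE.
Qed.

Lemma continuous_Re_sum b (q : E -> C) :
  continuous (fun v => complex.Re (\sum_x entry b v x * q x)).
Proof.
have -> : (fun v => complex.Re (\sum_x entry b v x * q x)) =
   (fun v => \sum_x (v 0 (enum_rank (b, false, x)) * complex.Re (q x)
                    + v 0 (enum_rank (b, true, x)) * - complex.Im (q x))).
  apply/funext => v; rewrite (raddf_sum (@complex.Re R)).
  apply: eq_bigr => x _; rewrite /entry; case: (q x) => s t /=.
  by rewrite mulrN.
have ck k (a : R) : continuous (fun v : 'rV[R]_N => v 0 k * a).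
  by move=> v; apply: continuousM; [exact: continuous_coord | exact: cst_continuous].
pose re x (v : 'rV[R]_N) := v 0 (enum_rank (b, false, x)) * complex.Re (q x).
pose im x (v : 'rV[R]_N) := v 0 (enum_rank (b, true, x)) * - complex.Im (q x).
have c2 x : continuous (fun v => re x v + im x v).
  by move=> v; apply: (@continuousD _ _ _ (re x)); exact: ck.
exact: continuous_sum.
Qed.

Lemma qform_map_of_entries k b v (X : 'M[C]_(k * d1)) x :
  qform (tensmap (fun Y : 'M[C]_k => Y) (map_of_entries b v) X) x =
  \sum_y entry b v y * qform (tensmap (fun Y : 'M[C]_k => Y) (entry_map y) X) x.
Proof.
rewrite tensmap_sumr.
have qs (I : finType) (F : I -> 'M[C]_(k * d2)) :
    qform (\sum_i F i) x = \sum_i qform (F i) x.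
  by rewrite /qform mulmx_sumr mulmx_suml summxE.
by rewrite qs; apply: eq_bigr => y _; rewrite tensmapZr qformZ.
Qed.

(** Expresses complex nonnegativity by real inequalities: the factors i and - i force the imaginary
    part to vanish. *)
Lemma ge0_of_Re (z : C) :
  (forall c, c \in [:: 1; 'i; - 'i] -> 0 <= complex.Re (c * z)) -> 0 <= z.
Proof.
case: z => a b H; have := H 1; have := H ('i); have := H (- 'i).
rewrite !inE !eqxx !orbT; simpc => /= /(_ isT) h1 /(_ isT) h2 /(_ isT) h3.
rewrite h3 andbT.
by rewrite eq_le; apply/andP; lra.
Qed.

(** Rather than extracting a convergent subsequence, minimize the squared distance from L to T +
    transposed S over a compact set of pairs; the approximations force the minimum to be 0. *)
Lemma decomposable_limit (L : {linear 'M[C]_d1 -> 'M[C]_d2}) :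
  (forall e : R, 0 < e -> e <= 1 -> exists2 L' : 'M[C]_d1 -> 'M[C]_d2,
     decomposable L' & forall i j k l,
     `|L (delta_mx i j) k l - L' (delta_mx i j) k l| <= e%:C) ->
  decomposable L.
Proof.
move=> H.
(* Bounds the diagonal values L'(E_ii)_kk of every approximation within 1. Those of T and S are
   nonnegative and add up to them, so they obey the same bound, and [cp_entry_le] contributes the
   factor 2. *)
pose B : R := \sum_(x : E) complex.Re `|L (delta_mx x.1.1.1 x.1.1.2) x.1.2 x.2| + 1.
pose K (v : 'rV[R]_N) := [/\ completely_positive (map_of_entries false v),
  completely_positive (map_of_entries true v) & forall j, `|v 0 j| <= 2 * B].
(* K is closed because it is cut out by the continuous functions that are
   nonnegative on it. *)
pose I := {F : 'rV[R]_N -> R | continuous F /\ forall v, K v -> 0 <= F v}.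
have KI v : (forall i : I, 0 <= sval i v) <-> K v.
  split=> [Iv|Kv [F [cF HF]]]; last exact: HF.
  have IF (F : 'rV[R]_N -> R) : continuous F -> (forall v, K v -> 0 <= F v) -> 0 <= F v.
    by move=> cF HF; apply: (Iv (exist _ F (conj cF HF))).
  have cp b : (forall v, K v -> completely_positive (map_of_entries b v)) ->
      completely_positive (map_of_entries b v).
    move=> Kb k X pX; apply/psdP => x; apply: ge0_of_Re => c cI.
    pose q y := c * qform (tensmap (fun Y : 'M[C]_k => Y) (entry_map y) X) x.
    have qE w : c * qform (tensmap (fun Y : 'M[C]_k => Y) (map_of_entries b w) X) x =
        \sum_y entry b w y * q y.
      by rewrite qform_map_of_entries mulr_sumr; apply: eq_bigr => y _; rewrite mulrCA.
    rewrite qE; apply: (IF (fun w => complex.Re (\sum_y entry b w y * q y))).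
      exact: continuous_Re_sum.
    move=> w /Kb cw; rewrite -qE.
    have := psd_ge0 x (cw k X pX); rewrite lecE => /andP [].
    move: (qform _ x) => [s t] /= /eqP t0 s0.
    by move: cI; rewrite !inE t0 => /or3P [] /eqP ->; simpc => /=; rewrite ?oppr0.
  split.
  - by apply: cp => w [].
  - by apply: cp => w [].
  move=> j; rewrite ler_norml; apply/andP; split.
    rewrite -subr_ge0 opprK.
    apply: (IF (fun w => w 0 j + 2 * B)) => [w|w [_ _ /(_ j)]].
      apply: (@continuousD _ _ _ (fun w : 'rV[R]_N => w 0 j)); first exact: continuous_coord.
      exact: cst_continuous.
    by rewrite ler_norml => /andP [h _]; lra.
  rewrite -subr_ge0.
  apply: (IF (fun w => 2 * B - w 0 j)) => [w|w [_ _ /(_ j)]].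
    apply: (@continuousB _ _ _ (fun w : 'rV[R]_N => 2 * B)); first exact: cst_continuous.
    exact: continuous_coord.
  by rewrite ler_norml => /andP [_ h]; lra.
(* The output indices of the second map are swapped because it enters transposed. *)
pose z (x : E) v := L (delta_mx x.1.1.1 x.1.1.2) x.1.2 x.2 - entry false v x
  - entry true v (x.1.1.1, x.1.1.2, x.2, x.1.2).
pose dist v := \sum_(x : E) (complex.Re (z x v) ^+ 2 + complex.Im (z x v) ^+ 2).
have approx e : 0 < e -> e <= 1 -> exists2 w, K w & dist w <= #|{: E}|%:R * e ^+ 2.
  move=> e0 e1; have [L' [T [S [cT [cS L'E]]]] LL'] := H e e0 e1.
  have [w [wT wS wE]] := map_of_entries_ex T S.
  exists w; last first.
    rewrite -sum1_card natr_sum mulr_suml; apply: ler_sum => x _; rewrite mul1r.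
    rewrite -lecR add_Re2_Im2.
    have -> : z x w = L (delta_mx x.1.1.1 x.1.1.2) x.1.2 x.2
        - L' (delta_mx x.1.1.1 x.1.1.2) x.1.2 x.2.
      rewrite /z L'E !mxE -wT -wS !map_of_entries_delta opprD addrA.
      by case: x => [[[? ?] ?] ?].
    rewrite rmorphXn; apply: lerXn2r; rewrite ?nnegrE ?normr_ge0 //.
      by rewrite ler0c ltW.
  split.
  - exact: eq_cp (fsym wT) cT.
  - exact: eq_cp (fsym wS) cS.
  have diag0 (F : {linear 'M[C]_d1 -> 'M[C]_d2}) i k : completely_positive F ->
      0 <= F (delta_mx i i) k k.
    by move=> cF; apply/psd_diag_ge0/(cp_positive cF)/psd_delta.
  have L'TS i k : L' (delta_mx i i) k k = T (delta_mx i i) k k + S (delta_mx i i) k k.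
    by rewrite L'E mxE; congr (_ + _); rewrite mxE.
  have L'B i k : L' (delta_mx i i) k k <= B%:C.
    have p0 : 0 <= L' (delta_mx i i) k k.
      rewrite L'TS; exact: addr_ge0 (diag0 T i k cT) (diag0 S i k cS).
    rewrite -(ger0_norm p0); apply: le_trans (_ : `|L (delta_mx i i) k k| + 1 <= _).
      rewrite -[X in `|X|](subrK (L (delta_mx i i) k k)) addrC.
      apply: le_trans (ler_normD _ _) _; rewrite lerD2l distrC.
      by apply: le_trans (LL' _ _ _ _) _; rewrite -(rmorph1 (real_complex R)) lecR.
    rewrite /B rmorphD rmorph1 lerD2r -(RRe_real (normr_real _)) lecR.
    rewrite (bigD1 (i, i, k, k)) //= lerDl sumr_ge0 // => x _.
    have := normr_ge0 (L (delta_mx x.1.1.1 x.1.1.2) x.1.2 x.2).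
    by rewrite lecE => /andP [].
  have FB (F : {linear 'M[C]_d1 -> 'M[C]_d2}) i j k l : completely_positive F ->
      (forall i k, F (delta_mx i i) k k <= L' (delta_mx i i) k k) ->
      `|F (delta_mx i j) k l| <= (2 * B)%:C.
    move=> cF FL; apply: le_trans (cp_entry_le i j k l cF) _.
    rewrite mulr_natl rmorphMn mulr2n; apply: lerD; exact: le_trans (FL _ _) (L'B _ _).
  have ReIm (y : C) b : `|y| <= b%:C -> `|complex.Re y| <= b /\ `|complex.Im y| <= b.
    move=> yb; have re := le_trans (normc_ge_Re y) yb.
    have p : `|y * 'i| <= b%:C -> `|complex.Im y| <= b.
      by move=> /(le_trans (normc_ge_Re _)); rewrite ReiNIm normrN lecR.
    rewrite lecR in re; split=> //; apply: p.
    by rewrite normrM (_ : `|'i| = 1) ?mulr1 // complexiE normCi.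
  move=> j; rewrite wE; case: (enum_val j) => [[b c] [[[i' j'] k'] l']] /=.
  have [] := ReIm ((if b then S else T) (delta_mx i' j') k' l') (2 * B); last by case: c.
  case: b.
    apply: (FB S _ _ _ _ cS) => i k.
    rewrite L'TS lerDr; exact: (diag0 T i k cT).
  apply: (FB T _ _ _ _ cT) => i k.
  rewrite L'TS lerDl; exact: (diag0 S i k cS).
have [||||||v Kv Hv] := @max_ratio_ex R N I sval (2 * B) (fun v => - dist v) (fun _ => 1).
- by move=> [F [cF HF]].
- have cB (a : R) k l : continuous (fun w : 'rV[R]_N => a - w 0 k - w 0 l).
    move=> w; apply: (@continuousB _ _ _ (fun w : 'rV[R]_N => a - w 0 k)).
      apply: (@continuousB _ _ _ (fun w : 'rV[R]_N => a)).
        exact: cst_continuous.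
      exact: continuous_coord.
    exact: continuous_coord.
  pose pos b c (x : E) : 'I_N := enum_rank (b, c, x).
  pose sw (x : E) : E := (x.1.1.1, x.1.1.2, x.2, x.1.2).
  pose l (x : E) : C := L (delta_mx x.1.1.1 x.1.1.2) x.1.2 x.2.
  pose re (x : E) (w : 'rV[R]_N) : R :=
    complex.Re (l x) - w 0 (pos false false x) - w 0 (pos true false (sw x)).
  pose im (x : E) (w : 'rV[R]_N) : R :=
    complex.Im (l x) - w 0 (pos false true x) - w 0 (pos true true (sw x)).
  have cq x : continuous (fun w => re x w * re x w + im x w * im x w).
    move=> w; apply: (@continuousD _ _ _ (fun w => re x w * re x w)).
      by apply: continuousM; apply: cB.
    by apply: continuousM; apply: cB.
  have -> : (fun w => - dist w) =
      (fun w => - \sum_x (re x w * re x w + im x w * im x w)).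
    apply/funext => w; congr (- _); apply: eq_bigr => x _.
    by rewrite !expr2 /z /entry /re /im -/(l x); case: (l x) => s t /=.
  move=> w; apply: continuousN; exact: continuous_sum.
- by move=> v; apply: cst_continuous.
- by move=> v /KI [].
- by move=> v _; exact: ltr01.
- by have [w /KI Kw _] := approx 1 ltr01 (lexx 1); exists w.
have {}Hv w : K w -> dist v <= dist w.
  by move=> /KI /Hv; rewrite !divr1 lerN2.
have dge0 x : 0 <= complex.Re (z x v) ^+ 2 + complex.Im (z x v) ^+ 2.
  by rewrite addr_ge0 // sqr_ge0.
have d0 : dist v = 0.
  apply/eqP; rewrite eq_le sumr_ge0 // andbT leNgt; apply/negP => dv.
  set m : R := #|{: E}|%:R in approx.
  have m0 : 0 <= m := ler0n _ _.
  have m1 : 0 < m + 1 by lra.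
  (* Small enough for a contradiction: m e^2 <= m e < (m + 1) e <= dist v. *)
  pose e := Num.min 1 (dist v / (m + 1)).
  have e0 : 0 < e by rewrite lt_min ltr01 divr_gt0.
  have e1 : e <= 1 by rewrite ge_min lexx.
  have e2 : e <= dist v / (m + 1) by rewrite ge_min lexx orbT.
  have [w Kw dw] := approx e e0 e1.
  have := le_trans (Hv w Kw) dw; rewrite ler_pdivlMr // in e2.
  have : e ^+ 2 <= e by rewrite expr2 ger_pMl.
  by nra.
have z0 x : z x v = 0.
  move/eqP: d0; rewrite psumr_eq0 // => /allP /(_ x (mem_index_enum _)) /=.
  rewrite paddr_eq0 ?sqr_ge0 // !sqrf_eq0; case: (z x v) => s t /=.
  by move=> /andP [/eqP -> /eqP ->].
have [cT cS _] := (KI v).1 Kv.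
exists [the {linear 'M[C]_d1 -> 'M[C]_d2} of map_of_entries false v].
exists [the {linear 'M[C]_d1 -> 'M[C]_d2} of map_of_entries true v].
split; [exact: cT | split; [exact: cS | move=> X /=]].
pose G := [the {linear 'M[C]_d1 -> 'M[C]_d2} of
  map_of_entries false v \+ (trmx \o map_of_entries true v)].
apply: (linear_delta_ext (F := L) (G := G)).
move=> i j; apply/matrixP => k l; rewrite /G /= !mxE !map_of_entries_delta.
by have /eqP := z0 (i, j, k, l); rewrite /z /= -addrA -opprD subr_eq0 => /eqP.
Qed.
End Closedness.

(** * Removing the perturbation *)

Section Main.
Variable R : realType.
Local Notation C := (R[i]).

Lemma square_decomposable_positive (P : {linear 'M[C]_2 -> 'M[C]_2}) :
  positive_map P -> square_decomposable P.
Proof.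
move=> pP pPP.
pose M1 X := tensmap P (@trace_id C) X + tensmap (@trace_id C) P X.
pose M2 := tensmap (@trace_id C) (@trace_id C).
pose h (x : 'I_(2 * 2) * 'I_(2 * 2) * 'I_(2 * 2) * 'I_(2 * 2)) : C :=
  `|M1 (delta_mx x.1.1.1 x.1.1.2) x.1.2 x.2|
  + `|M2 (delta_mx x.1.1.1 x.1.1.2) x.1.2 x.2|.
have h0 x : 0 <= h x by rewrite addr_ge0.
(* Bounds the entries of the first-order and second-order terms together, so that c = e / S moves
   each entry by at most e; the summand 1 ensures c <= 1. *)
pose S : C := 1 + \sum_x h x.
have Sle i j k l : h (i, j, k, l) <= S.
  apply: le_trans (_ : \sum_x h x <= _); last by rewrite lerDr ler01.
  by rewrite (bigD1 (i, j, k, l)) //= lerDl sumr_ge0.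
have S1 : 1 <= S by rewrite lerDl sumr_ge0.
have S0 : 0 < S := lt_le_trans ltr01 S1.
apply: (@decomposable_limit R _ _ [the {linear _ -> _} of tensmap P P]) => e e0 e1.
pose c : C := (real_complex R e) / S.
have c0 : 0 < c by rewrite divr_gt0 // ltcR.
have c1 : c <= 1.
  rewrite ler_pdivrMr // mul1r; apply: le_trans S1.
  by rewrite -(rmorph1 (real_complex R)) lecR.
exists (tensmap (depolarize c P) (depolarize c P)).
  apply: (@square_decomposable_depolarize R c P c0 pP).
  exact: positive_tensmap_depolarize (ltW c0) pP pPP.
move=> i j k l; rewrite distrC /=.
have -> : tensmap (depolarize c P) (depolarize c P) (delta_mx i j) k l -
   tensmap P P (delta_mx i j) k l =
   c * (M1 (delta_mx i j) k l + c * M2 (delta_mx i j) k l).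
  rewrite tensmap_depolarize -/(M1 _) -/(M2 _).
  have mE (A B D : 'M[C]_(2 * 2)) :
      (A + c *: (B + c *: D)) k l = A k l + c * (B k l + c * D k l).
    by rewrite !mxE.
  by rewrite mE addrAC subrr add0r.
have ce : real_complex R e = c * S by rewrite divfK // gt_eqF.
rewrite ce normrM gtr0_norm // ler_pM2l //.
apply: le_trans (Sle i j k l); apply: le_trans (ler_normD _ _) _.
by rewrite lerD2l normrM ler_piMl // gtr0_norm.
Qed.

End Main.

Theorem theorem1 (R : realType) (P : {linear 'M[R[i]]_2 -> 'M[R[i]]_2}) :
  positive_map (tensmap P P) <-> decomposable (tensmap P P).
Proof.
split; last exact: decomposable_positive.
move=> pPP; have [pP|nP] := positive_or_opp pPP.
  exact: square_decomposable_positive.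
pose Q := [the {linear 'M[R[i]]_2 -> 'M[R[i]]_2} of (-1) \*: P].
have N : tensmap Q Q =1 tensmap P P.
  by move=> X; rewrite tensmapZl tensmapZr scalerA mulrNN mulr1 scale1r.
apply: (eq_decomposable N); apply: square_decomposable_positive.
  by apply: eq_positive nP => X; rewrite /Q /= scaleN1r.
exact: eq_positive (fsym N) pPP.
Qed.
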